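(* For every finite simple graph $G$, \[\mathrm{ch}(G)\leq\max\left\{\chi(G),\left\lceil\frac{|V(G)|+\chi(G)-1}{3}\right\rceil\right\}.\]
   Context: Graphs are finite and simple. $\chi(G)$ denotes the chromatic number of $G$, and $V(G)$ its vertex set. A list assignment $L$ of $G$ assigns to each vertex $v$ of $G$ a set $L(v)$ of colours. An acceptable colouring for $L$ is a proper vertex colouring $f$ of $G$ such that $f(v)\in L(v)$ for every $v\in V(G)$. The graph $G$ is $k$-choosable if there is an acceptable colouring for $L$ whenever $|L(v)|\geq k$ for all $v\in V(G)$. The choice number $\mathrm{ch}(G)$ is the minimum $k$ such that $G$ is $k$-choosable. *)

(* Defs.v *)
From mathcomp Require Import all_boot all_order all_algebra.
From mathcomp Require Import boolp classical_sets functions cardinality.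

Set Implicit Arguments.
Unset Strict Implicit.
Unset Printing Implicit Defensive.

Local Open Scope classical_set_scope.
Local Open Scope card_scope.

Record sgraph := SGraph {
  vertex :> finType;
  edge : rel vertex;
  edge_sym : symmetric edge;
  edge_irrefl : irreflexive edge
}.

Definition proper_colouring (G : sgraph) (C : Type) (f : G -> C) : Prop :=
  forall x y : G, edge x y -> f x <> f y.

Definition colourable (G : sgraph) (k : nat) : Prop :=
  exists f : G -> 'I_k, proper_colouring f.

Definition acceptable (G : sgraph) (C : Type) (L : G -> set C) (f : G -> C) :
    Prop :=
  proper_colouring f /\ forall v, L v (f v).

(* Lists may be infinite; [`I_k #<= L v] says that [L v] has at least [k]
   elements. *)
Definition choosable (G : sgraph) (k : nat) : Prop :=
  forall (C : Type) (L : G -> set C),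
    (forall v, `I_k #<= L v) -> exists f : G -> C, acceptable L f.

Lemma colourable_card (G : sgraph) : colourable G #|G|.
Proof.
exists enum_rank => x y exy /enum_rank_inj xy.
by rewrite xy edge_irrefl in exy.
Qed.

Lemma choosable_card (G : sgraph) : choosable G #|G|.
Proof.
move=> C L hL.
have /choice[f0 f0L] : forall v, exists c, L v c.
  move=> v; have /card_leP[g] := hL v.
  have v0 : `I_#|G| 0%N by apply/card_gt0P; exists v.
  by exists (val (g (SigSub (mem_set v0)))); exact: set_valP.
have sdr (s : seq G) : uniq s -> exists f : G -> C,
    (forall v, L v (f v)) /\ {in s &, injective f}.
  elim: s => [_|x s IHs /= /andP[xs us]]; first by exists f0.
  have [f [fL finj]] := IHs us.
  have [c Lc cf] : exists2 c, L x c & ~ (f @` [set` s]) c.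
    apply: contrapT => h.
    have sub : L x `<=` f @` [set` s].
      by move=> c Lc; apply: contrapT => cf; apply: h; exists c.
    have : `I_#|G| #<= `I_(size s).
      apply: (card_le_trans (hL x)).
      apply: (card_le_trans (subset_card_le sub)).
      apply: (card_le_trans (card_image_le _ _)).
      have -> : [set` s] = nth x s @` `I_(size s).
        apply/seteqP; split=> [y /= ys|y /= [i si <-]]; last exact: mem_nth.
        by exists (index y s); rewrite /= ?index_mem ?nth_index.
      exact: card_image_le.
    rewrite card_le_II; apply/negP; rewrite -ltnNge.
    have /card_uniqP sz : uniq (x :: s) by rewrite /= xs.
    by rewrite -[_ < _]/(size (x :: s) <= _) -sz; exact: max_card.
  exists (fun y => if y == x then c else f y); split=> [v|y z].
    by case: eqP => [->|].
  rewrite !inE; case: (eqVneq y x) => [->|yx]; case: (eqVneq z x) => [->|zx] //=.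
  - by move=> _ zs cz; case: cf; exists z.
  - by move=> ys _ yc; case: cf; exists y.
  - exact: finj.
have [f [fL finj]] := sdr _ (enum_uniq G).
exists f; split=> // x y exy fxy.
have xy : x = y by apply: finj; rewrite ?mem_enum.
by rewrite xy edge_irrefl in exy.
Qed.

Lemma ex_colourable (G : sgraph) : exists k, `[< colourable G k >].
Proof. by exists #|G|; apply/asboolP; exact: colourable_card. Qed.

Lemma ex_choosable (G : sgraph) : exists k, `[< choosable G k >].
Proof. by exists #|G|; apply/asboolP; exact: choosable_card. Qed.

Definition chi (G : sgraph) : nat := ex_minn (ex_colourable G).

Definition ch (G : sgraph) : nat := ex_minn (ex_choosable G).

(* Main.v *)
(** The colour classes of a [chi]-colouring are kept as parts, and a list colouring
    is sought in which equal colours occur only inside a part, i.e. a colouring of a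
    complete multipartite graph with [k] parts and [n] vertices from lists of size
    [r], where [k <= r] and [n + k <= 3 * r + 1].  Take a counterexample with [n],
    and then the number of colours, minimal.  Any set of colours can then be matched
    into the vertices seeing it, so that fewer than [n] colours occur.  Group
    vertices of the same part, a group being meant to receive one colour.  By
    Hall's theorem some set [S] of groups has fewer than [#|S|] colours in common
    lists; unless [S] is unbalanced (lemma [violator]) its ungrouped vertices can
    be coloured by induction.

    If [k < r], the minimality forces [n + k = 3 * r + 1] and parts of size at most
    4, and no colour is shared by three vertices of a part.  The groups are pairs of
    vertices of the same part with many common colours, at most one per part, and
    counting the colours seen by [S] gives a contradiction.

    If [k = r] (this is Ohba's conjecture, [n <= 2 * k + 1]), the groups are the
    colour classes of an almost acceptable colouring, in which one vertex per colour
    of a small set [J] of frequent colours may receive that colour although it is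
    not in its list.  The violating [S] then yields a colour of [J] seen by few
    vertices, which contradicts the double counting of the pairs (vertex, colour of
    its list). *)

Require Import Defs.
From mathcomp Require Import all_boot all_order all_algebra.
From mathcomp Require Import zify.

Set Implicit Arguments.
Unset Strict Implicit.
Unset Printing Implicit Defensive.

(** * Hall's theorem *)

Lemma card_setUD (T : finType) (A B : {set T}) : #|A :|: B| = #|A :\: B| + #|B|.
Proof. by rewrite -(cardsID B (A :|: B)) (setIidPr (subsetUr A B)) setDUl setDv setU0
  addnC. Qed.

Section Hall.
Variables (N C : finType) (c0 : C).
Implicit Types (R : N -> {set C}) (D S : {set N}).

Definition nbh R S := \bigcup_(x in S) R x.

(** A system of distinct representatives of the sets [R x], for [x] in [D]. *)
Definition sdr R D (f : N -> C) :=
  {in D, forall x, f x \in R x} /\ {in D &, injective f}.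

Lemma nbhP R S c : reflect (exists2 x, x \in S & c \in R x) (c \in nbh R S).
Proof. exact: bigcupP. Qed.

Lemma nbhU R S S' : nbh R (S :|: S') = nbh R S :|: nbh R S'.
Proof.
apply/setP => c; rewrite inE; apply/nbhP/orP => [[x]|].
  by rewrite inE => /orP[] xS cx; [left|right]; apply/nbhP; exists x.
by case=> /nbhP[x xS cx]; exists x => //; rewrite inE xS ?orbT.
Qed.

Lemma nbhD R S S' : nbh (fun x => R x :\: nbh R S) S' = nbh R S' :\: nbh R S.
Proof.
apply/setP => c; rewrite inE; apply/nbhP/andP => [[y yS']|[cS /nbhP[y yS' cy]]].
  by rewrite inE => /andP[cS cy]; split=> //; apply/nbhP; exists y.
by exists y => //; rewrite inE cS.
Qed.

(** Induction on [#|D|]. If some proper nonempty subset is tight, it is matched first and the rest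
    is matched outside its neighbourhood; otherwise all such subsets have a neighbour to spare, and
    any choice for one element can be extended. *)
Lemma hall R D : (forall S, S \subset D -> #|S| <= #|nbh R S|) ->
  exists f, sdr R D f.
Proof.
have [q] := ubnP #|D|; elim: q R D => // q IH R D /ltnSE leDq hD.
have [->|[x xD]] := set_0Vmem D.
  by exists (fun=> c0); split=> ?; rewrite inE.
case: (boolP [exists S : {set N}, [&& S \proper D, S != set0 & #|nbh R S| <= #|S|]]).
  case/existsP => S /and3P[SD S0 tight].
  have [f [fR fI]] : exists f, sdr R S f.
    apply: IH; first by apply: leq_trans (proper_card SD) _.
    by move=> S' S'S; apply: hD; apply: subset_trans S'S (proper_sub SD).
  pose R' y := R y :\: nbh R S.
  have [g [gR gI]] : exists g, sdr R' (D :\: S) g.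
    apply: IH.
      have := cardsID S D; rewrite (setIidPr (proper_sub SD)).
      by move: S0; rewrite -card_gt0; lia.
    move=> S' /subsetDP[S'D dS'].
    have := hD (S' :|: S); rewrite subUset S'D (proper_sub SD) => /(_ isT).
    rewrite cardsU disjoint_setI0 // cards0 subn0 nbhU.
    rewrite /R' nbhD card_setUD.
    by lia.
  exists (fun y => if y \in S then f y else g y); split=> [y yD|y z yD zD].
    case: ifP => yS; first exact: fR.
    by have := gR y; rewrite !inE yS yD => /(_ isT) /andP[].
  have gout y' : y' \in D -> y' \notin S -> g y' \notin nbh R S.
    by move=> yD' yS'; have := gR y'; rewrite !inE yS' yD' => /(_ isT) /andP[].
  have fin y' : y' \in S -> f y' \in nbh R S by move=> yS'; apply/nbhP; exists y' => //;
    apply: fR.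
  case: ifPn => yS; case: ifPn => zS.
  - exact: fI.
  - by move=> e; have := gout z zD zS; rewrite -e fin.
  - by move=> e; have := gout y yD yS; rewrite e fin.
  - by apply: gI; rewrite !inE ?yS ?zS.
rewrite negb_exists => /forallP noT.
have [c cx] : exists c, c \in R x.
  have := hD [set x]; rewrite sub1set xD cards1 => /(_ isT).
  by rewrite card_gt0 => /set0Pn[c /nbhP[y]]; rewrite inE => /eqP-> cx; exists c.
pose R' y := R y :\ c.
have [g [gR gI]] : exists g, sdr R' (D :\ x) g.
  apply: IH; first by move: leDq; rewrite (cardsD1 x) xD.
  move=> S' S'D; have [->|S'0] := eqVneq S' set0; first by rewrite cards0.
  have := noT S'; rewrite S'0 (sub_proper_trans S'D) ?properD1 //= -ltnNge => lt.
  have -> : nbh R' S' = nbh R S' :\ c.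
    apply/setP => d; rewrite !inE; apply/nbhP/andP => [[y yS']|[dc /nbhP[y yS' dy]]].
      by rewrite !inE => /andP[dc dy]; split=> //; apply/nbhP; exists y.
    by exists y => //; rewrite !inE dc.
  by move: lt; rewrite (cardsD1 c (nbh R S')); case: (c \in _); lia.
exists (fun y => if y == x then c else g y); split=> [y yD|y z yD zD].
  case: eqP => [->//|/eqP yx]; have := gR y; rewrite !inE yx yD => /(_ isT) /andP[] //.
have gc y' : y' \in D -> y' != x -> g y' != c.
  by move=> yD' yx'; have := gR y'; rewrite !inE yx' yD' => /(_ isT) /andP[].
case: (eqVneq y x) => [->|yx]; case: (eqVneq z x) => [->|zx] //.
- by move=> e; have := gc z zD zx; rewrite -e eqxx.
- by move=> e; have := gc y yD yx; rewrite e eqxx.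
- by apply: gI; rewrite !inE ?yx ?zx.
Qed.

(* A set [S] of maximal deficiency leaves a complement that can be matched
   outside the neighbourhood of [S]. *)
Lemma hall_deficiency R D :
  (exists f, sdr R D f) \/
  exists S, [/\ S \subset D, #|nbh R S| < #|S| &
    exists f, sdr (fun x => R x :\: nbh R S) (D :\: S) f].
Proof.
case: (boolP [exists S : {set N}, (S \subset D) && (#|nbh R S| < #|S|)]); last first.
  rewrite negb_exists => /forallP h; left; apply: hall => S SD.
  by have := h S; rewrite SD /= -leqNgt.
case/existsP => S0 /andP[S0D lt0]; right.
(* The deficiency, shifted by [#|C|] to stay a natural number. *)
pose def (S : {set N}) := #|S| + (#|C| - #|nbh R S|).
case: (@arg_maxnP _ S0 (fun S : {set N} => S \subset D) def S0D) => S SD Smax.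
have hN (S' : {set N}) : #|nbh R S'| <= #|C| by rewrite -cardsT subset_leq_card ?subsetT.
exists S; split=> //; first by have := Smax S0 S0D; rewrite /def; move: (hN S) (hN S0); lia.
apply: hall => S' /subsetDP[S'D dS'].
have := Smax (S' :|: S); rewrite subUset S'D SD /def nbhU => /(_ isT).
rewrite cardsU disjoint_setI0 // cards0 subn0.
rewrite nbhD card_setUD; have := hN (S' :|: S); rewrite nbhU card_setUD.
by lia.
Qed.

End Hall.

(** * List colourings relative to a partition *)

Lemma card_fibres (T I : finType) (p : T -> I) (A : {set T}) (B : {set I}) :
  {in A, forall v, p v \in B} ->
  #|A| = \sum_(x in B) #|[set v in A | p v == x]|.
Proof.
move=> pAB; rewrite -sum1_card (partition_big p (mem B)) //=.
by apply: eq_bigr => x _; rewrite -sum1_card; apply: eq_bigl => v; rewrite inE.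
Qed.

Section ListColouring.
Variables (V K C : finType) (c0 : C) (pi : V -> K).
Implicit Types (L : V -> {set C}) (A B Z : {set V}) (X : {set C}).

(** List colourings of the complete multipartite graph whose parts are the fibres of [pi],
    restricted to [A]. *)
Definition listcol L A := exists f : V -> C,
  {in A, forall v, f v \in L v} /\ {in A &, forall u v, f u = f v -> pi u = pi v}.

Lemma listcolS L L' A :
  {in A, forall v, L v \subset L' v} -> listcol L A -> listcol L' A.
Proof.
by move=> sL [f [fL fP]]; exists f; split=> // v vA; apply: (subsetP (sL v vA)); apply: fL.
Qed.

(** One piece uses colours of [X] only, the other none of them, so no conflict crosses. *)
Lemma listcolU L X A B :
  listcol (fun v => L v :&: X) A -> listcol (fun v => L v :\: X) B ->
  listcol L (A :|: B).
Proof.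
move=> [f [fL fP]] [g [gL gP]]; exists (fun v => if v \in A then f v else g v).
have fX v : v \in A -> f v \in X by move/fL; rewrite inE => /andP[].
have gX v : v \in B -> g v \notin X by move/gL; rewrite inE => /andP[].
split=> [v|u v]; rewrite !inE.
  by case: ifP => /= [vA _|_ vB]; [move: (fL v vA)|move: (gL v vB)]; rewrite inE => /andP[].
case: ifP => uA; case: ifP => vA //= uB vB.
- exact: fP.
- by move=> e; have := gX _ vB; rewrite -e fX.
- by move=> e; have := gX _ uB; rewrite e fX.
- exact: gP.
Qed.

Definition seen L (U : {set C}) := [set v | ~~ [disjoint L v & U]].

Lemma seenP L (U : {set C}) v : reflect (exists2 c, c \in L v & c \in U) (v \in seen L U).
Proof.
rewrite inE; apply: (iffP pred0Pn) => [[c /andP[cL cU]]|[c cL cU]]; exists c => //.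
by rewrite /= cL cU.
Qed.

Lemma seenE L (U : {set C}) : seen L U = nbh (fun c => [set v | c \in L v]) U.
Proof.
by apply/setP => v; apply/seenP/nbhP => [[c cL cU]|[c cU]]; rewrite ?inE; exists c;
  rewrite ?inE.
Qed.

(* A minimal set [U] of colours seen by fewer than [#|U|] vertices can be
   matched onto the vertices seeing it; these vertices are coloured from [U], and
   the others from a list assignment that avoids [U]. *)
Lemma colours_matchable L r : (forall v, #|L v| = r) ->
  (forall L', (forall v, #|L' v| = r) ->
    #|nbh L' setT| < #|nbh L setT| -> listcol L' setT) ->
  ~ listcol L setT ->
  forall U : {set C}, U \subset nbh L setT -> #|U| <= #|seen L U|.
Proof.
move=> Lr IH nL U UC; rewrite leqNgt; apply/negP => lt.
case: (@arg_minnP _ U (fun U : {set C} =>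
  (U \subset nbh L setT) && (#|seen L U| < #|U|)) (fun U => #|U|)).
  by rewrite UC.
move=> {lt UC} {}U /andP[UC lt] Umin.
have [U0|[u uU]] := set_0Vmem U; first by move: lt; rewrite U0 cards0.
case: (set_0Vmem [set: V]) => [V0|[v1 _]].
  by apply: nL; exists (fun=> c0); rewrite V0; split=> ?; rewrite inE.
have sU : U :\ u \subset U by apply: subD1set.
have hallU (S : {set C}) : S \subset U :\ u ->
  #|S| <= #|nbh (fun c => [set v | c \in L v]) S|.
  move=> SU; rewrite -seenE leqNgt; apply/negP => lt'.
  have := Umin S; rewrite (subset_trans SU (subset_trans sU UC)) lt' => /(_ isT).
  by have := subset_leq_card SU; rewrite (cardsD1 u U) uU; lia.
have [m [mL mI]] := hall v1 hallU.
(* As [#|seen L U| < #|U|], the image of [U :\ u] is large enough to fill [seen L U]. *)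
have img : m @: (U :\ u) = seen L U.
  apply/eqP; rewrite eqEcard; apply/andP; split.
    apply/subsetP => v /imsetP[c cU ->]; apply/seenP; exists c; last exact: (subsetP sU).
    by have := mL c cU; rewrite inE.
  by rewrite card_in_imset //; move: lt; rewrite (cardsD1 u U) uU.
have colN : listcol (fun v => L v :&: U) (seen L U).
  pose f v := odflt c0 [pick c in U :\ u | m c == v].
  have fP v : v \in seen L U -> f v \in U :\ u /\ m (f v) = v.
    rewrite -img => /imsetP[c cU ->]; rewrite /f; case: pickP => [d /andP[dU /eqP]|] //.
    by move/(_ c); rewrite cU eqxx.
  exists f; split=> [v /fP[fU mf]|x y /fP[_ ex] /fP[_ ey] e].
    by rewrite inE (subsetP sU) // andbT; have := mL _ fU; rewrite mf inE.
  by rewrite -ex -ey e.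
have [NT|[v0]] := set_0Vmem (~: seen L U).
  apply: nL; have <- : seen L U = setT by rewrite -[LHS]setCK NT setC0.
  by apply: listcolS colN => v _; apply: subsetIl.
rewrite inE => v0N.
(* Vertices seeing [U] borrow the list of [v0], which avoids [U]: no colour is added and [u]
   disappears. *)
pose L' v := if v \in seen L U then L v0 else L v.
have LU v : v \notin seen L U -> [disjoint L v & U] by rewrite inE negbK.
have L'U v : [disjoint L' v & U] by rewrite /L'; case: ifPn => [_|]; exact: LU.
have : listcol L' setT.
  apply: IH => [v|]; first by rewrite /L'; case: ifP.
  apply: proper_card; apply/properP; split.
    apply/subsetP => c /nbhP[v _]; rewrite /L'; by case: ifP => _ cL; apply/nbhP;
      [exists v0|exists v].
  exists u; first exact: (subsetP UC).
  by apply/nbhP => -[v _ uL]; have := disjointFr (L'U v) uL; rewrite uU.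
case=> f [fL fP]; apply: nL.
have -> : [set: V] = seen L U :|: ~: seen L U by rewrite setUCr.
apply: (listcolU colN); exists f; split=> [v|u' v' _ _]; last by apply: fP.
rewrite inE => vN; have := fL v (in_setT _); rewrite /L' (negbTE vN) => fv.
by rewrite inE fv (disjointFr (LU v vN) fv).
Qed.

End ListColouring.

(* The situation of a minimal counterexample: [pi] maps a vertex to its part. *)
Record critical (V K C : finType) (pi : V -> K) (L : V -> {set C}) (r : nat) : Prop :=
  Critical {
  critical_surj : forall P, exists v, pi v = P;
  critical_list : forall v, #|L v| = r;
  critical_uncol : ~ listcol pi L setT;
  critical_parts : #|K| <= r;
  critical_order : #|V| + #|K| <= 3 * r + 1;
  critical_sub : forall (A : {set V}), A != setT -> forall (L' : V -> {set C}) r',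
    #|pi @: A| <= r' -> #|A| + #|pi @: A| <= 3 * r' + 1 ->
    {in A, forall v, r' <= #|L' v|} -> listcol pi L' A }.

(** * Consequences of minimality *)

Section Critical.
Variables (V K C : finType) (c0 : C) (pi : V -> K) (L : V -> {set C}) (r : nat).
Hypothesis crit : critical pi L r.
Let piS := critical_surj crit.
Let Lr := critical_list crit.
Let nL := critical_uncol crit.
Let kr := critical_parts crit.
Let nkr := critical_order crit.
Let IH := critical_sub crit.

(** [B] receives [c], and the other vertices are coloured by induction from lists of size [r.-1]
    without [c]; the last two hypotheses are the size conditions there. *)
Lemma class_removal (B : {set V}) c P : B \subset [set v | pi v == P] ->
  B != set0 -> {in B, forall v, c \in L v} -> 
  #|pi @: (~: B)| < r -> #|V| + #|pi @: (~: B)| + 2 < 3 * r + 1 + #|B| -> False.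
Proof.
move=> BP B0 cL k' n'; apply: (nL).
have -> : [set: V] = B :|: ~: B by rewrite setUCr.
apply: (@listcolU _ _ _ _ _ [set c]).
  exists (fun=> c); split=> [v vB|u v uB vB _]; first by rewrite !inE cL //=.
  by have := subsetP BP _ uB; have := subsetP BP _ vB; rewrite !inE => /eqP-> /eqP->.
apply: (@IH _ _ _ r.-1).
- by apply: contraNneq B0; rewrite -setC0 => /setC_inj->.
- by lia.
- by have := cardsC B; lia.
- by move=> v _; have := cardsD1 c (L v); rewrite Lr; case: (c \in _); lia.
Qed.

Lemma part_gt0 P : 0 < #|[set v | pi v == P]|.
Proof. by have [v <-] := piS P; rewrite card_gt0; apply/set0Pn; exists v; rewrite inE. Qed.

(** Giving [c] to the whole part removes one part and at least two vertices, which pays for lowering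
    [r] by 1. *)
Lemma no_common P c : 1 < #|[set v | pi v == P]| ->
  ~ (forall v, pi v = P -> c \in L v).
Proof.
move=> s2 cL; apply: (@class_removal [set v | pi v == P] c P) => //.
- by rewrite -card_gt0 ltnW.
- by move=> v; rewrite inE => /eqP; apply: cL.
all: have kP : #|pi @: (~: [set v | pi v == P])| < #|K|.
all: try (rewrite -cardsT; apply: proper_card; apply/properP; split; first exact: subsetT;
  by exists P => //; apply/imsetP => -[v]; rewrite !inE => /eqP vP e; apply: vP).
all: by lia.
Qed.

(** Three vertices alone pay for one colour; [#|K| < r] keeps the number of parts admissible even if
    none disappears. *)
Lemma no_common_triple P c (B : {set V}) : #|K| < r -> B \subset [set v | pi v == P] ->
  2 < #|B| -> ~ {in B, forall v, c \in L v}.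
Proof.
move=> ltk BP B3 cL; apply: (class_removal BP _ cL); first by rewrite -card_gt0; lia.
all: by have := max_card (pi @: (~: B)); lia.
Qed.

Section Violator.
Variables (N : finType) (p : V -> N) (d : N -> C).
Definition node_class x := [set v | p v == x].
Definition node_list x := \bigcap_(v | p v == x) L v.
Hypothesis p_pi : forall u v, p u = p v -> pi u = pi v.
Hypothesis dL : forall x, 1 < #|node_class x| -> d x \in node_list x.
Hypothesis dI : {in [pred x | 1 < #|node_class x|] &, injective d}.

(* Unless one of the three alternatives holds, the merged groups in [S] are coloured by [d], the groups outside [S] by
   Hall's theorem with colours not seen by [S], and the single vertices in [S] by
   induction, from the lists deprived of the colours used by [d]. *)
Lemma violator : exists S : {set N}, [/\ S \subset p @: setT, #|nbh node_list S| < #|S| &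
  let Z := [set v | (p v \in S) && (#|node_class (p v)| == 1)] in
  let b := #|[set x in S | 1 < #|node_class x|]| in
  let e := #|~: (pi @: Z)| in
  [\/ Z = setT, r + e < #|K| + b | #|[set v | p v \notin S]| + e < b]].
Proof.
have [[f [fL fI]]|[S [SD ltS [g [gL gI]]]]] := hall_deficiency c0 node_list (p @: setT).
  case: nL; exists (f \o p); split=> [v _|u v _ _ /= e].
    by have /bigcapP := fL (p v) (imset_f _ (in_setT v)); apply.
  by apply: p_pi; apply: fI; rewrite ?imset_f ?inE.
exists S; split=> // Z b e.
case: (eqVneq Z setT) => [->|ZT]; first by constructor.
case: (ltnP (r + e) (#|K| + b)) => h1; first by constructor.
case: (ltnP (#|[set v | p v \notin S]| + e) b) => h2; first by constructor.
case: nL.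
pose B := [set x in S | 1 < #|node_class x|].
pose Y := [set v | p v \in B].
pose W := [set v | p v \notin S].
have eK : #|pi @: Z| + e = #|K| by rewrite /e cardsC.
have clv v : v \in node_class (p v) by rewrite inE.
have cl1 v : 0 < #|node_class (p v)| by rewrite card_gt0; apply/set0Pn; exists v.
have nY : 2 * b <= #|Y|.
  have YB : {in Y, forall v, p v \in B} by move=> v; rewrite inE.
  rewrite (card_fibres YB) mulnC -sum_nat_const; apply: leq_sum => x.
  rewrite inE => /andP[xS x2]; apply: (leq_trans x2); apply: subset_leq_card.
  by apply/subsetP => v; rewrite !inE => /eqP->; rewrite xS eqxx x2.
have defT : [set: V] = (Y :|: Z) :|: W.
  apply/setP => v; rewrite !inE; case: (p v \in S) => //=; have := cl1 v.
  by case: #|node_class (p v)| => [|[|q]].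
have nZ : #|Z| + #|Y| + #|W| = #|V|.
  rewrite -cardsT defT !cardsU [Y :&: Z]disjoint_setI0 ?[_ :&: W]disjoint_setI0 ?cards0;
    first by lia.
    by apply/pred0P => v; rewrite /= !inE; case: (p v \in S); rewrite ?andbF.
  apply/pred0P => v; rewrite /= !inE; case: (p v \in S) => //=.
  by case: eqP => [->|]; rewrite ?andbF.
have lstL v : node_list (p v) \subset L v by apply: bigcap_inf.
rewrite defT; apply: (@listcolU _ _ _ _ _ (nbh node_list S)); last first.
  exists (g \o p); split=> [v|u v]; rewrite !inE => pu.
    have := gL (p v); rewrite inE pu imset_f ?inE // => /(_ isT) /andP[-> h].
    by rewrite (subsetP (lstL v)).
  by move=> pv eg; apply: p_pi; apply: gI; rewrite // inE ?pu ?pv imset_f ?inE.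
apply: (@listcolU _ _ _ _ _ (d @: B)).
  exists (d \o p) => /=; split=> [v|u v].
    rewrite inE => pB; rewrite inE imset_f // andbT inE.
    move: pB; rewrite inE => /andP[pS p2].
    rewrite (subsetP (lstL v)) ?dL //=; apply/nbhP; exists (p v) => //; exact: dL.
  by rewrite !inE => /andP[_ pu] /andP[_ pv] ed; apply: p_pi; apply: dI.
apply: (listcolS (L := fun v => L v :\: d @: B)).
  move=> v; rewrite inE => /andP[pS /eqP p1].
  apply/subsetP => c; rewrite !inE => /andP[-> cL]; rewrite cL /=.
  apply/nbhP; exists (p v) => //; apply/bigcapP => u; move: p1 => /eqP/cards1P[z ez].
  have:= clv v; rewrite ez inE => /eqP ev pu.
  by have : u \in node_class (p v); [rewrite inE|rewrite ez inE => /eqP->; rewrite -ev].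
have bB : #|d @: B| <= b by apply: leq_imset_card.
(* Merged groups in [S] contain at least [2 * b] vertices, and [h2] supplies a further [b]: together
   the cost of [b] colours. [h1] keeps the number of parts within [r - b]. *)
apply: (@IH _ ZT _ (r - b)).
- by lia.
- by move: h2; rewrite -/W; lia.
- move=> v _; rewrite cardsD Lr.
  by have := subset_leq_card (subsetIr (L v) (d @: B)); lia.
Qed.

End Violator.
End Critical.

(** * More colours than parts *)

Lemma card_sum_set (I J : finType) (S : {set I + J}) :
  #|S| = #|[set i | inl i \in S]| + #|[set j | inr j \in S]|.
Proof.
rewrite -sum1_card big_sumType /= -!sum1_card.
by congr (_ + _); apply: eq_bigl => x; rewrite inE.
Qed.

Lemma exists_subset_card (T : finType) (A : {set T}) q : q <= #|A| ->
  exists2 B : {set T}, B \subset A & #|B| = q.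
Proof.
move=> qA; exists [set x in take q (enum A)].
  by apply/subsetP => x; rewrite inE => /mem_take; rewrite mem_enum.
rewrite cardsE; have /card_uniqP-> : uniq (take q (enum A)) by rewrite take_uniq ?enum_uniq.
by rewrite size_take -cardE; case: ltnP => //; lia.
Qed.

Section Beyond.
Variables (V K C : finType) (c0 : C) (pi : V -> K) (L : V -> {set C}) (r : nat).
Hypothesis crit : critical pi L r.
Hypothesis ltk : #|K| < r.
Hypothesis fewC : #|nbh L setT| < #|V|.
Let Lr := critical_list crit.
Let nkr := critical_order crit.

Local Notation prt P := [set v | pi v == P].
Local Notation s P := #|prt P|.

Lemma card_parts : #|V| = \sum_P s P.
Proof.
rewrite -cardsT (card_fibres (p := pi) (B := setT)); last by move=> v; rewrite inE.
rewrite [LHS](eq_bigl xpredT) => [|P]; last by rewrite inE.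
by apply: eq_bigr => P _; apply: eq_card => v; rewrite !inE.
Qed.

Let v0 : V. Proof. by have /card_gt0P/sigW[v _] : 0 < #|V| by apply: leq_ltn_trans fewC.
  Qed.

Lemma max_part : exists P, #|V| <= #|K| * s P.
Proof.
have [P _ Pmax] := @arg_maxnP _ (pi v0) xpredT (fun P => s P) isT.
exists P; rewrite card_parts -sum_nat_const; apply: leq_sum => Q _; exact: Pmax.
Qed.

(** Double counting of the pairs of a vertex of [P] and a colour in its list. *)
Lemma sum_lists q P : (forall c, #|[set v in prt P | c \in L v]| <= q) ->
  s P * r <= q * #|nbh L setT|.
Proof.
move=> hq; have -> : s P * r = \sum_(v in prt P) #|L v|.
  by rewrite -sum_nat_const; apply: eq_bigr => v _; rewrite Lr.
have -> : \sum_(v in prt P) #|L v| = \sum_(v in prt P) \sum_(c in nbh L setT | c \in L v) 1.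
  apply: eq_bigr => v _; rewrite -sum1_card; apply: eq_bigl => c.
  by apply/idP/andP => [cv|[]//]; split=> //; apply/nbhP; exists v.
rewrite (exchange_big_dep (mem (nbh L setT))) /=; last by move=> v c _ /andP[].
rewrite mulnC -sum_nat_const; apply: leq_sum => c cC; apply: leq_trans (hq c).
rewrite -sum1_card leq_eqVlt; apply/orP; left; apply/eqP; apply: eq_bigl => v.
by rewrite !inE cC.
Qed.

Lemma card_pi (A : {set V}) : #|pi @: A| <= #|K|. Proof. exact: max_card. Qed.

(** With one unit to spare, even two vertices of a part sharing a colour could be removed. So lists
    within a part are disjoint, and a largest part sees at least [#|V|] colours. *)
Lemma beyond_tight : #|V| + #|K| = 3 * r + 1.
Proof.
apply/eqP; rewrite eqn_leq nkr leqNgt; apply/negP => lt.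
have [P maxP] := max_part.
have : s P * r <= 1 * #|nbh L setT|.
  apply: sum_lists => c; rewrite leqNgt; apply/negP => lt2.
  apply: (class_removal crit (B := [set v in prt P | c \in L v]) (c := c) (P := P)).
  - by apply/subsetP => v; rewrite !inE => /andP[].
  - by rewrite -card_gt0 ltnW.
  - by move=> v; rewrite !inE => /andP[].
  - by have := card_pi (~: [set v in prt P | c \in L v]); lia.
  - by have := card_pi (~: [set v in prt P | c \in L v]); lia.
by nia.
Qed.

Lemma triple_free P c : #|[set v in prt P | c \in L v]| <= 2.
Proof.
rewrite leqNgt; apply/negP => lt2.
apply: (@no_common_triple _ _ _ _ _ _ crit P c _ ltk _ lt2).
  by apply/subsetP => v; rewrite !inE => /andP[].
by move=> v; rewrite !inE => /andP[].
Qed.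

Lemma part_le4 P : s P <= 4.
Proof.
have [Q maxQ] := max_part.
have [Q' _ Q'max] := @arg_maxnP _ (pi v0) xpredT (fun P => s P) isT.
apply: leq_trans (Q'max P isT) _.
have nQ' : #|V| <= #|K| * s Q' by apply: leq_trans maxQ _; rewrite leq_mul //; exact: Q'max.
have := sum_lists (triple_free Q').
have := beyond_tight; have : 0 < #|K| by apply/card_gt0P; exists P.
case: (leqP (s Q') 4) => // h5 k0 t; case: (ltnP 5 (s Q')) => [h6|h6].
  by nia.
(* Size 5 is the borderline: the counts give [2 * #|K| <= r] and [3 * r + 1 <= 6 * #|K|]. *)
have -> : s Q' = 5 by lia.
have e5 : s Q' = 5 by lia.
by move: nQ'; rewrite e5; lia.
Qed.

(** * Common colours of pairs and triples in a part *)

Definition comm u v := #|L u :&: L v|.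
Local Notation l := comm.

Lemma commC u v : l u v = l v u. Proof. by rewrite /comm setIC. Qed.

(** By [triple_free]; this stops inclusion-exclusion inside a part at pairs. *)
Lemma triple_disj u v w : pi u = pi v -> pi w = pi v -> u != v -> u != w -> v != w ->
  L u :&: L v :&: L w = set0.
Proof.
move=> uv wv nuv nuw nvw; apply/setP => c; rewrite !inE;
  apply/negP => /andP[/andP[cu cv] cw].
have := triple_free (pi v) c; rewrite leqNgt => /negP; apply.
have -> : 2 = #|[set u; v]| by rewrite cards2 nuv.
apply: proper_card; apply/properP; split.
  by apply/subsetP => x; rewrite !inE => /orP[] /eqP->; rewrite ?uv ?eqxx.
by exists w; rewrite !inE ?wv ?eqxx // negb_or ![w == _]eq_sym nuw nvw.
Qed.

Lemma card_union2 u v : #|L u :|: L v| + l u v = 2 * r.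
Proof. by rewrite cardsU !Lr /comm; have := subset_leq_card (subsetIl (L u) (L v));
  rewrite Lr; lia. Qed.

Lemma card_union_pair v a b : pi a = pi b -> pi v = pi b -> a != b -> v != a -> v != b ->
  #|L v :|: (L a :&: L b)| = r + l a b.
Proof.
by move=> ab vb nab nva nvb; rewrite cardsU Lr [L v :&: _]setIC triple_disj ?cards0
  ?subn0 // 1?eq_sym.
Qed.

Lemma card_union_pair2 u v a b : pi a = pi b -> pi u = pi b -> pi v = pi b ->
  a != b -> u != v -> u != a -> u != b -> v != a -> v != b ->
  #|L u :|: L v :|: (L a :&: L b)| + l u v = 2 * r + l a b.
Proof.
move=> ab ub vb nab nuv nua nub nva nvb; rewrite cardsU.
have -> : (L u :|: L v) :&: (L a :&: L b) = set0.
  by rewrite setIC setIUr !triple_disj ?setU0 // 1?eq_sym.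
by rewrite cards0 subn0; have := card_union2 u v; rewrite /comm; lia.
Qed.

Definition tri u v w := l u v + l u w + l v w.

(** The two intersections are disjoint subsets of [L w]. *)
Lemma comm2_le u v w : pi u = pi v -> pi w = pi v -> u != v -> u != w -> v != w ->
  l u w + l v w <= r.
Proof.
move=> uv wv nuv nuw nvw; rewrite -(Lr w) /comm -cardsUI.
have -> : L u :&: L w :&: (L v :&: L w) = set0.
  by rewrite setIACA setIid; apply: triple_disj.
by rewrite cards0 addn0 subset_leq_card // subUset !subsetIr.
Qed.

Lemma card_union3 u v w : pi u = pi v -> pi w = pi v -> u != v -> u != w -> v != w ->
  #|L u :|: L v :|: L w| + tri u v w = 3 * r.
Proof.
move=> uv wv nuv nuw nvw; rewrite cardsU Lr setIUl /tri.
have -> : #|L u :&: L w :|: L v :&: L w| = l u w + l v w.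
  rewrite cardsU.
  have -> : L u :&: L w :&: (L v :&: L w) = set0; last by rewrite cards0 subn0.
  by rewrite setIACA setIid; apply: triple_disj.
have := card_union2 u v.
by have := comm2_le uv wv nuv nuw nvw; lia.
Qed.

Definition pairmax P := \max_(e : V * V | [&& pi e.1 == P,
  pi e.2 == P & e.1 != e.2]) l e.1 e.2.

Definition trimax P := \max_(t : V * V * V | [&& pi t.1.1 == P, pi t.1.2 == P, pi t.2 == P,
  t.1.1 != t.1.2, t.1.1 != t.2 & t.1.2 != t.2]) tri t.1.1 t.1.2 t.2.

Lemma leq_pairmax u v : pi u = pi v -> u != v -> l u v <= pairmax (pi v).
Proof.
move=> uv nuv; rewrite /pairmax.
apply: (leq_bigmax_cond (F := fun e : V * V => l e.1 e.2) (u, v)).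
by rewrite /= uv !eqxx.
Qed.

Lemma leq_trimax u v w : pi u = pi v -> pi w = pi v -> u != v -> u != w -> v != w ->
  tri u v w <= trimax (pi v).
Proof.
move=> uv wv nuv nuw nvw; rewrite /trimax.
apply: (leq_bigmax_cond (F := fun t : V * V * V => tri t.1.1 t.1.2 t.2) (u, v, w)).
by rewrite /= uv wv !eqxx nuv nuw.
Qed.

Lemma pairmaxP P : 1 < s P -> exists a b, [/\ pi a = P, pi b = P,
  a != b & l a b = pairmax P].
Proof.
move/card_gt1P => [x [y []]]; rewrite !inE => xP yP nxy.
have h : 0 < #|[pred e : V * V | [&& pi e.1 == P, pi e.2 == P & e.1 != e.2]]|.
  by apply/card_gt0P; exists (x, y); rewrite inE /= xP yP.
have [[a b]] := eq_bigmax_cond (fun e : V * V => l e.1 e.2) h.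
rewrite inE /= => /and3P[/eqP aP /eqP bP nab] e; exists a, b; split=> //.
Qed.

Lemma trimaxP P : 2 < s P -> exists u v w,
  [/\ pi u = P, pi v = P, pi w = P, [&& u != v, u != w & v != w] & tri u v w = trimax P].
Proof.
move/card_gt2P => [x [y [z [[]]]]]; rewrite !inE => xP yP zP [nxy nyz nzx].
have h : 0 < #|[pred t : V * V * V | [&& pi t.1.1 == P, pi t.1.2 == P, pi t.2 == P,
  t.1.1 != t.1.2, t.1.1 != t.2 & t.1.2 != t.2]]|.
  by apply/card_gt0P; exists (x, y, z); rewrite inE /= xP yP zP nxy nyz eq_sym nzx.
have [[[a b] c]] := eq_bigmax_cond (fun t : V * V * V => tri t.1.1 t.1.2 t.2) h.
rewrite inE /= => /and5P[/eqP aP /eqP bP /eqP cP nab nbc] e; exists a, b, c; split=> //.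
by rewrite nab.
Qed.

(* Twice [half_order] plus the number of even parts is [3 * r + 1]; a part is strong
   if two of its vertices share so many colours that, once merged, the pair and a
   further vertex of the part see at least [half_order] colours. *)
Definition half_order := \sum_P uphalf (s P).
Definition even_parts := [set P | ~~ odd (s P)].

(** Doubling [uphalf] adds 1 for odd parts; counting even parts adds 1 for the others. The total is
    [#|V| + #|K|]. *)
Lemma half_evens : 2 * half_order + #|even_parts| = 3 * r + 1.
Proof.
rewrite -beyond_tight card_parts -[#|K|]sum1_card -big_split /half_order big_distrr /=.
rewrite -sum1_card [X in _ + X](big_mkcond _) -big_split /=.
apply: eq_bigr => P _; rewrite inE uphalf_half; move: (s P) => q.
by have := odd_double_half q; case: (odd q) => /=; lia.
Qed.

Definition big_parts := [set P | 2 < s P].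
(** Two vertices with fewer than [sigma] common colours see at least
    [2 * r + 1 - sigma = half_order] colours, whereas [r + sigma = half_order + #|even_parts|] by
    [half_evens]. *)
Definition sigma := 2 * r + 1 - half_order.
Definition strong_parts := [set P in big_parts | sigma <= pairmax P].

Lemma trimax_le3 P : P \in big_parts -> trimax P <= 3 * pairmax P.
Proof.
rewrite inE => /trimaxP[u [v [w [uP vP wP /and3P[nuv nuw nvw] <-]]]]; rewrite /tri.
have := @leq_pairmax u v; have := @leq_pairmax u w; have := @leq_pairmax v w.
by rewrite uP vP wP => /(_ erefl nvw) h1 /(_ erefl nuw) h2 /(_ erefl nuv) h3; lia.
Qed.

Lemma trimax_le_r P : P \in big_parts -> trimax P <= r + pairmax P.
Proof.
rewrite inE => /trimaxP[u [v [w [uP vP wP /and3P[nuv nuw nvw] <-]]]]; rewrite /tri.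
have := @leq_pairmax u v; have := @comm2_le u v w.
rewrite uP vP wP => /(_ erefl erefl nuv nuw nvw) h1 /(_ erefl nuv) h2; lia.
Qed.

(** * Pairs to merge and the colours they offer *)

Section Merging.
Variable Q : {set K}.

(* [Q] is the set of the parts in which a pair with most common colours must be
   chosen. In the other parts any pair will do that has enough common colours and
   at least as many as the complementary pair. *)
Definition mergeable a b := [&& a != b, pi a == pi b, trimax (pi a) <= r + l a b,
  [forall c, forall d, [&& pi c == pi a, pi d == pi a, c != d,
     c \notin [:: a; b] & d \notin [:: a; b]] ==> (l c d <= l a b)] &
  (pi a \in Q) ==> (l a b == pairmax (pi a))].

Lemma mergeableP a b : reflect [/\ a != b, pi a = pi b, trimax (pi a) <= r + l a b,
   (forall c d, pi c = pi a -> pi d = pi a -> c != d -> c \notin [:: a; b] ->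
     d \notin [:: a; b] -> l c d <= l a b) & (pi a \in Q -> l a b = pairmax (pi a))]
  (mergeable a b).
Proof.
apply: (iffP and5P) => -[nab].
  move=> /eqP pab lm /forallP dom /implyP h; split=> // [c d ca da ncd cab dab|/h/eqP//].
  by have /forallP/(_ d)/implyP := dom c; rewrite ca da !eqxx ncd cab dab; apply.
move=> pab lm dom h; split=> //; first exact/eqP.
  by apply/forallP => c; apply/forallP => d;
    apply/implyP => /and5P[/eqP ca /eqP da ncd cab dab]; apply: dom.
by apply/implyP => /h/eqP.
Qed.

Definition merge_colours P := [set c | [exists a, exists b, [&& pi a == P, mergeable a b,
  c \in L a & c \in L b]]].

Lemma merge_coloursP P c : reflect (exists a b, [/\ pi a = P, mergeable a b,
  c \in L a & c \in L b])
  (c \in merge_colours P).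
Proof.
rewrite inE; apply: (iffP existsP) =>
  [[a /existsP[b /and4P[/eqP aP ab ca cb]]]|[a [b [aP ab ca cb]]]].
  by exists a, b.
by exists a; apply/existsP; exists b; rewrite aP eqxx ab ca cb.
Qed.

Lemma merge_colours_sub a b : mergeable a b -> L a :&: L b \subset merge_colours (pi a).
Proof. by move=> ab; apply/subsetP => c; rewrite inE => /andP[ca cb];
  apply/merge_coloursP; exists a, b. Qed.

(** A pair attaining [pairmax] is mergeable, by [trimax_le_r]. *)
Lemma card_merge_colours_best P : P \in big_parts -> P \in Q ->
  pairmax P <= #|merge_colours P|.
Proof.
move=> bigP PQ; have s2 : 2 < s P by move: bigP; rewrite inE.
have [a [b [aP bP nab e]]] := pairmaxP (ltnW s2).
rewrite -e -aP; apply: subset_leq_card; apply: merge_colours_sub.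
apply/mergeableP; split=> //; rewrite ?aP ?bP //; first by rewrite e trimax_le_r.
by move=> c d cP dP ncd _ _; rewrite e -dP leq_pairmax // cP.
Qed.

Lemma pair_disj a b c d : pi a = pi b -> pi c = pi b -> pi d = pi b -> a != b ->
  (c \notin [:: a; b]) || (d \notin [:: a; b]) ->
  (L a :&: L b) :&: (L c :&: L d) = set0.
Proof.
move=> ab cb db nab; rewrite !inE !negb_or => h.
case/orP: h => /andP[h1 h2].
  by rewrite setIA triple_disj ?set0I // eq_sym.
by rewrite [L c :&: _]setIC setIA triple_disj ?set0I // eq_sym.
Qed.

(* Applied to one pair of each of the three perfect matchings of a part of size 4. *)
Lemma card_pairs3 P a1 b1 a2 b2 a3 b3 : pi a1 = P -> pi a2 = P -> pi a3 = P ->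
  mergeable a1 b1 -> mergeable a2 b2 -> mergeable a3 b3 ->
  (a2 \notin [:: a1; b1]) || (b2 \notin [:: a1; b1]) ->
  (a3 \notin [:: a1; b1]) || (b3 \notin [:: a1; b1]) ->
  (a3 \notin [:: a2; b2]) || (b3 \notin [:: a2; b2]) ->
  l a1 b1 + l a2 b2 + l a3 b3 <= #|merge_colours P|.
Proof.
move=> p1 p2 p3 m1 m2 m3 n21 n31 n32.
have [n1 q1 _ _ _] := mergeableP _ _ m1; have [n2 q2 _ _ _] := mergeableP _ _ m2.
have [n3 q3 _ _ _] := mergeableP _ _ m3.
have d21 : (L a1 :&: L b1) :&: (L a2 :&: L b2) = set0 by apply: pair_disj => //; congruence.
have d31 : (L a1 :&: L b1) :&: (L a3 :&: L b3) = set0 by apply: pair_disj => //; congruence.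
have d32 : (L a2 :&: L b2) :&: (L a3 :&: L b3) = set0 by apply: pair_disj => //; congruence.
have : #|(L a1 :&: L b1) :|: (L a2 :&: L b2) :|: (L a3 :&: L b3)| <= #|merge_colours P|.
  apply: subset_leq_card; rewrite !subUset.
  by rewrite -{1}p1 -{1}p2 -p3 !merge_colours_sub.
apply: leq_trans; rewrite /comm cardsU setIUl d31 d32 setU0 cards0 subn0.
by rewrite cardsU d21 cards0 subn0.
Qed.

(** Take a triple attaining [trimax]. Each of its pairs is mergeable or, in a part of size 4, may be
    replaced by a complementary pair with more common colours. The three resulting pairs have
    disjoint sets of common colours. *)
Lemma card_merge_colours_dom P : P \in big_parts -> P \notin Q ->
  trimax P <= #|merge_colours P|.
Proof.
rewrite inE => s2 PQ.
have [u [v [w [uP vP wP /and3P[nuv nuw nvw] e]]]] := trimaxP s2.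
have nvu : v != u by rewrite eq_sym. have nwu : w != u by rewrite eq_sym.
have nwv : w != v by rewrite eq_sym.
(* The two pairs other than [a], [b] contribute at most [r], by [comm2_le]. *)
have third a b c : pi a = P -> pi b = P -> pi c = P -> a != b -> a != c -> b != c ->
  tri u v w = l a b + l a c + l b c -> trimax P <= r + l a b.
  move=> aP bP cP nab nac nbc et; rewrite -e et.
  rewrite -addnA addnC leq_add2r.
  by have := @comm2_le a b c; rewrite aP bP cP => /(_ erefl erefl nab nac nbc).
have t1 := third u v w uP vP wP nuv nuw nvw erefl.
have t2 : trimax P <= r + l u w.
  by apply: (third u w v) => //; rewrite /tri [l w v]commC; lia.
have t3 : trimax P <= r + l v w.
  by apply: (third v w u) => //; rewrite /tri [l w u]commC [l v u]commC; lia.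
rewrite -e /tri.
case: (boolP [forall x, (pi x == P) ==> (x \in [:: u; v; w])]) => [/forallP all3|].
  have all3' x : pi x = P -> [|| x == u, x == v | x == w].
    by move=> xP; have := all3 x; rewrite xP eqxx !inE.
  have E := (eqxx, negbTE nuv, negbTE nuw, negbTE nvw, negbTE nvu, negbTE nwu, negbTE nwv).
  have m3 a b c : pi a = P -> pi b = P -> a != b -> trimax P <= r + l a b ->
    (forall x, pi x = P -> [|| x == a, x == b | x == c]) -> mergeable a b.
    move=> aP bP nab lb all; apply/mergeableP; split; rewrite ?aP ?bP ?(negbTE PQ) //.
    move=> y z /all + /all; rewrite !inE => /or3P[] /eqP-> /or3P[] /eqP->;
      by rewrite ?eqxx ?orbT.
  apply: card_pairs3 => //; try (by rewrite !inE !E).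
  - exact: (@m3 u v w).
  - by apply: (@m3 u w v) => // x /all3'; rewrite orbCA orbC -orbA => /or3P[]->;
    rewrite ?orbT.
  - by apply: (@m3 v w u) => // x /all3' /or3P[]->; rewrite ?orbT.
rewrite negb_forall => /existsP[x]; rewrite negb_imply !inE => /andP[/eqP xP].
rewrite !negb_or => /and3P[nxu nxv nxw].
have nux : u != x by rewrite eq_sym. have nvx : v != x by rewrite eq_sym.
have nwx : w != x by rewrite eq_sym.
have all4 y : pi y = P -> [|| y == u, y == v, y == w | y == x].
  move=> yP; rewrite -[_ || _]negbK; apply/negP;
    rewrite !negb_or => /and4P[nyu nyv nyw nyx].
  have := part_le4 P; apply/negP; rewrite -ltnNge.
  have /card_uniqP/= <- : uniq [:: y; u; v; w; x].
    by rewrite /= !inE !negb_or nyu nyv nyw nyx nuv nuw nux nvw nvx nwx.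
  apply: subset_leq_card; apply/subsetP => z; rewrite !inE.
  by case/or4P => [/eqP->|/eqP->|/eqP->|/orP[]/eqP->]; apply/eqP.
have choice a b c d : pi a = P -> pi b = P -> pi c = P -> pi d = P -> a != b -> c != d ->
  (forall y, pi y = P -> [|| y == a, y == b, y == c | y == d]) -> trimax P <= r + l a b ->
  exists e, [/\ e = (a, b) \/ e = (c, d), mergeable e.1 e.2 & l a b <= l e.1 e.2].
  move=> aP bP cP dP nab ncd all lb.
  case: (leqP (l c d) (l a b)) => cmp; [exists (a, b)|exists (c, d)]; split;
    rewrite /= ?(ltnW cmp) //;
   try (by [left|right]); apply/mergeableP; split; rewrite ?aP ?bP ?cP ?dP ?(negbTE PQ) //.
  - move=> y z yP zP; move: (all y yP) (all z zP); rewrite !inE.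
    by case/or4P => /eqP-> /or4P[] /eqP->; rewrite ?eqxx ?orbT //= => *;
      rewrite 1?[l d c]commC.
  - by apply: leq_trans lb _; rewrite leq_add2l ltnW.
  - move=> y z yP zP; move: (all y yP) (all z zP); rewrite !inE.
    by case/or4P => /eqP-> /or4P[] /eqP->; rewrite ?eqxx ?orbT //= => *;
      rewrite 1?[l b a]commC ltnW.
have E := (eqxx, negbTE nuv, negbTE nuw, negbTE nvw, negbTE nvu, negbTE nwu, negbTE nwv,
  negbTE nxu, negbTE nxv, negbTE nxw, negbTE nux, negbTE nvx, negbTE nwx).
have [e1 [h1 m1 i1]] := choice u v w x uP vP wP xP nuv nwx all4 t1.
have [e2 [h2 m2 i2]] : exists e, [/\ e = (u, w) \/ e = (v, x),
  mergeable e.1 e.2 & l u w <= l e.1 e.2].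
  by apply: choice => // y /all4; case/or4P => ->; rewrite ?orbT.
have [e3 [h3 m3 i3]] : exists e, [/\ e = (v, w) \/ e = (u, x),
  mergeable e.1 e.2 & l v w <= l e.1 e.2].
  by apply: choice => // y /all4; case/or4P => ->; rewrite ?orbT.
apply: leq_trans (leq_add (leq_add i1 i2) i3) _.
apply: card_pairs3 => //.
- by case: h1 => ->.
- by case: h2 => ->.
- by case: h3 => ->.
- by case: h1 => ->; case: h2 => ->; rewrite /= !inE !E.
- by case: h1 => ->; case: h3 => ->; rewrite /= !inE !E.
- by case: h2 => ->; case: h3 => ->; rewrite /= !inE !E.
Qed.

End Merging.

(* The parts outside [M] have few common colours and those in [M :\: Ms] many, the
   bound depending on [#|M|]. *)
Lemma threshold (Ms : {set K}) : Ms \subset big_parts -> exists M : {set K},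
  [/\ Ms \subset M, M \subset big_parts,
      {in big_parts :\: M, forall P, trimax P + #|V| <= 3 * r + #|M|} &
      {in M :\: Ms, forall P, 3 * r + #|M| <= trimax P + #|V|}].
Proof.
(* The ordering clause lets [ok] survive the removal of a part with least [trimax]: the parts
   already outside have no larger value, so they satisfy the bound lowered by 1. *)
move=> MsB; pose ok (M : {set K}) := [&& Ms \subset M, M \subset big_parts,
  [forall P in big_parts :\: M, trimax P + #|V| <= 3 * r + #|M|] &
  [forall R in big_parts :\: M, forall P in M :\: Ms, trimax R <= trimax P]].
have okbig : ok big_parts.
  by apply/and4P; split=> //; apply/forall_inP => P; rewrite setDv in_set0.
case: (arg_minnP (fun M : {set K} => #|M|) okbig) =>
  M /and4P[MsM MB /forall_inP out /forall_inP ord] Mmin.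
exists M; split=> // P PM; rewrite leqNgt; apply/negP => lt.
case: (arg_minnP trimax PM) => R RM0 Rmin.
have RM : R \in M :\: Ms by exact: RM0.
have RM' : R \in M by move: RM; rewrite inE => /andP[].
have cM : #|M| = #|M :\ R|.+1 by rewrite (cardsD1 R) RM'.
have lR := Rmin P PM.
have /Mmin : ok (M :\ R); last by rewrite cM ltnn.
have sM : M :\ R \subset M by apply: subD1set.
have inD U : U \in big_parts :\: (M :\ R) -> U = R \/ U \in big_parts :\: M.
  by rewrite !inE negb_and negbK => /andP[/orP[/eqP->|->] ->]; [left|right].
apply/and4P; split.
- apply/subsetP => U UMs; rewrite !inE (subsetP MsM) // andbT.
  by apply/eqP => e; move: RM; rewrite -e inE UMs.
- exact: subset_trans MB.
- have lamR : trimax R + #|V| <= 3 * r + #|M :\ R|.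
    have : trimax R + #|V| < 3 * r + #|M| by apply: leq_ltn_trans lt; rewrite leq_add2r.
    by rewrite cM addnS ltnS.
  apply/forall_inP => U /inD[->//|UM]; apply: leq_trans lamR; rewrite leq_add2r.
  by have /forall_inP/(_ R RM) := ord U UM.
apply/forall_inP => U /inD[->|UM]; apply/forall_inP => U' U'M.
  by apply: Rmin; apply: subsetP U'M; apply: setSD.
by have /forall_inP := ord U UM; apply; apply: subsetP U'M; apply: setSD.
Qed.

(** Hall's condition needs only one part of [S]: a part outside [Ms :|: E] offers at least [#|M|]
    colours, a strong one at least [sigma], and if [S] lies in [E] one colour suffices. *)
Lemma merge_colours_sdr (Ms E M : {set K}) : Ms \subset strong_parts -> Ms \subset M ->
  E \subset M ->
  M \subset big_parts -> #|E| <= 1 -> #|Ms :|: E| <= sigma ->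
  {in M :\: Ms, forall P, 3 * r + #|M| <= trimax P + #|V|} ->
  exists d, sdr (merge_colours (Ms :|: E)) M d.
Proof.
move=> Mstr MsM EM MB E1 Qs hM; apply: (hall c0) => S SM.
have lamM P : P \in M :\: Ms -> 0 < trimax P /\ #|M| <= trimax P.
  move=> PM; have := hM P PM; have := beyond_tight.
  have : 0 < #|K| by apply/card_gt0P; exists P.
  have : 0 < #|M| by apply/card_gt0P; exists P; move: PM; rewrite inE => /andP[].
  by lia.
have sub P : P \in S -> #|merge_colours (Ms :|: E) P| <= #|nbh (merge_colours (Ms :|: E))
  S|.
  by move=> PS; apply: subset_leq_card; apply: bigcup_sup.
case: (boolP (S \subset Ms :|: E)) => [SQ|/subsetPn[P PS PQ]]; last first.
  apply: leq_trans (sub P PS); apply: leq_trans (card_merge_colours_dom _ PQ); last first.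
    by apply: (subsetP MB); apply: (subsetP SM).
  apply: leq_trans (subset_leq_card SM) _; apply: (lamM P _).2.
  by rewrite inE (subsetP SM) // andbT; apply: contraNN PQ; rewrite inE => ->.
case: (boolP [disjoint S & Ms]) => [dS|/pred0Pn[P /andP[/= PS PMs]]]; last first.
  apply: leq_trans (sub P PS); apply: leq_trans (card_merge_colours_best _ (subsetP SQ P
    PS)).
    apply: leq_trans (subset_leq_card SQ) _; apply: leq_trans Qs _.
    by have := subsetP Mstr P PMs; rewrite inE => /andP[].
  by apply: (subsetP MB); apply: (subsetP SM).
have SE : S \subset E.
  apply/subsetP => P PS; have := subsetP SQ P PS; rewrite inE => /orP[|//].
  by rewrite (disjointFr dS PS).
have [->|[P PS]] := set_0Vmem S; first by rewrite cards0.
apply: leq_trans (subset_leq_card SE) _; apply: leq_trans E1 _.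
apply: leq_trans (sub P PS); apply: leq_trans (card_merge_colours_best _ (subsetP SQ P PS)).
  have PB : P \in big_parts by apply: (subsetP MB); apply: (subsetP SM).
  have [l0 _] : 0 < trimax P /\ #|M| <= trimax P.
    by apply: lamM; rewrite inE (subsetP SM) // andbT (disjointFr dS PS).
  by have := leq_trans l0 (trimax_le3 PB); rewrite muln_gt0.
by apply: (subsetP MB); apply: (subsetP SM).
Qed.

(* One pair is merged in each part of [M]. [Ms] consists of strong parts; [E]
   contains at most one other part, used only if all strong parts are in [Ms]. *)
Section Analysis.
Variables (Ms E M : {set K}) (d : K -> C).
Hypotheses (Mstr : Ms \subset strong_parts) (MsM : Ms \subset M) (EM : E \subset M :\:
  Ms) (MB : M \subset big_parts).
Hypothesis E1 : #|E| <= 1.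
Hypothesis outM : {in big_parts :\: M, forall P, trimax P + #|V| <= 3 * r + #|M|}.
Hypothesis inM : {in M :\: Ms, forall P, 3 * r + #|M| <= trimax P + #|V|}.
Hypothesis dM : sdr (merge_colours (Ms :|: E)) M d.
Hypothesis dicho : #|Ms| = sigma \/ Ms = strong_parts /\ #|strong_parts| < sigma /\ (E =
  set0 -> M = Ms).

Let Q := Ms :|: E.
(** Groups live in a sum type: [inr P] is the pair merged in [P], [inl v] a single vertex. Exactly
    two vertices of [P] have [d P] in their lists, see [node_pair]. *)
Let p v : V + K := if (pi v \in M) && (d (pi v) \in L v) then inr (pi v) else inl v.

Lemma node_inr v P : p v = inr P -> [/\ pi v = P, P \in M & d P \in L v].
Proof. by rewrite /p; case: ifP => // /andP[vM dv] [<-]. Qed.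

Lemma node_inl u v : p u = inl v -> u = v.
Proof. by rewrite /p; case: ifP => // _ []. Qed.

Lemma node_pi u v : p u = p v -> pi u = pi v.
Proof.
case e: (p v) => [w|P] => [/node_inl->|/node_inr[-> _ _]]; first by move/node_inl: e => ->.
by have [->] := node_inr e.
Qed.

Lemma node_pair P : P \in M -> exists a b, [/\ pi a = P, mergeable Q a b &
  node_class p (inr P) = [set a; b]].
Proof.
move=> PM; have /merge_coloursP[a [b [aP ab da db]]] := dM.1 P PM; exists a, b; split=> //.
have [nab pab _ _ _] := mergeableP _ _ _ ab.
apply/setP => v; rewrite !inE; apply/eqP/orP => [/node_inr[vP _ dv]|]; last first.
  by case=> /eqP->; rewrite /p -?pab aP PM ?da ?db.
case: (eqVneq v a) => [_|nva]; first by left.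
case: (eqVneq v b) => [_|nvb]; first by right.
have nav : a != v by rewrite eq_sym. have nbv : b != v by rewrite eq_sym.
have vb : pi v = pi b by rewrite -pab aP.
by have /setP/(_ (d P)) := triple_disj pab vb nab nav nbv; rewrite !inE da db dv.
Qed.

Lemma card_node_inl v : #|node_class p (inl v)| <= 1.
Proof.
rewrite -(cards1 v); apply: subset_leq_card; apply/subsetP => u; rewrite !inE.
by move/eqP/node_inl->.
Qed.

Lemma card_node_inr P : P \in M -> #|node_class p (inr P)| = 2.
Proof.
by move/node_pair => [a [b [_ /mergeableP[nab _ _ _ _] ->]]]; rewrite cards2 nab.
Qed.

(** * Counting the colours seen by a violating set *)

Section Violating.
Variable S : {set V + K}.
Hypothesis Simg : S \subset p @: setT.
Let X := nbh (node_list L p) S.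
Hypothesis ltXS : #|X| < #|S|.
Let Z := [set v | inl v \in S].
Let Y := [set P | inr P \in S].
Let z P := #|[set v in Z | pi v == P]|.
Let y P : nat := P \in Y.

Lemma single_node v : v \in Z -> p v = inl v.
Proof.
rewrite inE => /(subsetP Simg)/imsetP[u _ e].
by have := esym e => /node_inl uv; rewrite e uv.
Qed.

Lemma merged_node P : P \in Y -> P \in M.
Proof. by rewrite inE => /(subsetP Simg)/imsetP[u _ /esym/node_inr[]]. Qed.

Lemma singleE : Z = [set v | (p v \in S) && (#|node_class p (p v)| == 1)].
Proof.
apply/setP => v; rewrite [in RHS]inE; apply/idP/andP => [vZ|[vS]].
  rewrite single_node //; split; first by move: vZ; rewrite inE.
  rewrite eqn_leq card_node_inl card_gt0; apply/set0Pn; exists v.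
  by rewrite inE single_node.
case e: (p v) vS => [u|P] vS; first by move/node_inl: e => ->; rewrite inE.
by have [_ PM _] := node_inr e; rewrite card_node_inr.
Qed.

Lemma card_mergedE : #|[set x in S | 1 < #|node_class p x|]| = #|Y|.
Proof.
rewrite -(card_imset _ (@inr_inj V K)); apply: eq_card => x; rewrite inE.
apply/andP/imsetP => [[xS x2]|[P PY ->]].
  by case: x xS x2 => [v|P] xS; [rewrite ltnNge card_node_inl|exists P; rewrite ?inE].
by rewrite card_node_inr ?merged_node //; split=> //; move: PY; rewrite inE.
Qed.

Lemma cardS : #|S| = #|Z| + #|Y|. Proof. exact: card_sum_set. Qed.

Lemma cardZ : #|Z| = \sum_P z P.
Proof.
rewrite (card_fibres (p := pi) (B := setT)) => [|v]; last by rewrite inE.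
by apply: eq_bigl => P; rewrite inE.
Qed.

Lemma cardY : #|Y| = \sum_P y P.
Proof. by rewrite -sum1_card big_mkcond; apply: eq_bigr => P _; rewrite /y;
  case: (_ \in _). Qed.

Lemma cardM : #|M| = \sum_P (P \in M : nat).
Proof. by rewrite -sum1_card big_mkcond; apply: eq_bigr => P _; case: (_ \in _). Qed.

Lemma y_le P : y P <= (P \in M).
Proof. by rewrite /y; case: (boolP (P \in Y)) => // /merged_node->. Qed.

Lemma z_le P : z P <= s P.
Proof. by apply: subset_leq_card; apply/subsetP => v; rewrite !inE => /andP[]. Qed.

Lemma single_sub v : v \in Z -> L v \subset X.
Proof.
move=> vZ; have /subset_trans : L v \subset node_list L p (inl v).
  by apply/bigcapsP => u /eqP/node_inl->.
by apply; apply: bigcup_sup; move: vZ; rewrite inE.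
Qed.

Lemma two_single u v : u \in Z -> v \in Z -> 2 * r <= #|X| + l u v.
Proof.
move=> uZ vZ; rewrite -(card_union2 u v) leq_add2r subset_leq_card //.
by rewrite subUset !single_sub.
Qed.

Lemma pairP P : P \in M -> exists a b, [/\ pi a = P, mergeable Q a b,
  {in Z, forall v, v != a /\ v != b} & P \in Y -> L a :&: L b \subset X].
Proof.
move=> PM; have [a [b [aP ab cab]]] := node_pair PM; exists a, b; split=> // [v vZ|PY].
  have := single_node vZ; have : v \notin node_class p (inr P) by rewrite inE single_node.
  by rewrite cab !inE negb_or => /andP.
have /subset_trans : L a :&: L b \subset node_list L p (inr P).
  apply/bigcapsP => v pv; have : v \in node_class p (inr P) by rewrite inE.
  by rewrite cab !inE => /orP[] /eqP->; rewrite ?subsetIl ?subsetIr.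
by apply; apply: bigcup_sup; move: PY; rewrite inE.
Qed.

Lemma z_merged P : P \in M -> z P + 2 <= s P.
Proof.
move=> PM; have [a [b [aP /mergeableP[nab pab _ _ _] abZ _]]] := pairP PM.
have -> : 2 = #|[set a; b]| by rewrite cards2 nab.
rewrite -[_ + _]cardsUI.
have -> : [set v in Z | pi v == P] :&: [set a; b] = set0.
  apply/setP => v; rewrite !inE; apply/negP => /andP[/andP[vZ _]].
  by have [|/negbTE-> /negbTE->] := abZ v; rewrite ?inE.
rewrite cards0 addn0; apply: subset_leq_card; apply/subsetP => v; rewrite !inE.
by case/orP => [/andP[]//|/orP[] /eqP->]; rewrite -?pab aP.
Qed.

Lemma card_nodes : #|S| + #|M| <= #|V|.
Proof.
rewrite cardS cardZ cardY cardM card_parts -!big_split; apply: leq_sum => P _ /=.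
have := y_le P; have := z_le P; have := @z_merged P.
by case: (P \in M) => [/(_ isT)|_]; lia.
Qed.

(** Three single vertices of [P] would see at least [3 * r - trimax P], hence at least [#|V| - #|M|]
    colours, which is no less than [#|S|] by [card_nodes]. *)
Lemma z_unmerged P : P \in big_parts :\: M -> z P <= 2.
Proof.
move=> PM; rewrite leqNgt; apply/negP => /card_gt2P[u [v [w [[]]]]].
rewrite !inE => /andP[uZ /eqP uP] /andP[vZ /eqP vP] /andP[wZ /eqP wP] [nuv nvw nwu].
have nuw : u != w by rewrite eq_sym.
have := @card_union3 u v w; have := @leq_trimax u v w.
rewrite uP vP wP => /(_ erefl erefl nuv nuw nvw) h1 /(_ erefl erefl nuv nuw nvw) h2.
have : #|L u :|: L v :|: L w| <= #|X|.
  by apply: subset_leq_card; rewrite !subUset !single_sub ?inE.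
by move: (outM PM) card_nodes h1 h2 ltXS; clear; lia.
Qed.

Lemma ex_single_miss : Z != setT.
Proof.
apply/eqP => ZT.
have zs P : z P = s P by rewrite /z ZT; apply: eq_card => v; rewrite !inE.
have : #|V| <= #|K| * 2.
  rewrite card_parts -sum_nat_const; apply: leq_sum => P _; rewrite leqNgt;
    apply/negP => PB.
  case: (boolP (P \in M)) => PM; first by have := z_merged PM; rewrite zs; lia.
  by have := @z_unmerged P; rewrite !inE PB PM zs => /(_ isT); lia.
by move: beyond_tight; clear -ltk; lia.
Qed.

Let W := [set v | p v \notin S].

(** Part by part: a merged part has at most 4 vertices, and an unmerged one has at most 2 outside
    [W]. *)
Lemma leftover : #|V| <= 2 * #|K| + #|W| + 2 * #|M|.
Proof.
have -> : #|W| = \sum_P #|[set v in W | pi v == P]|.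
  rewrite (card_fibres (p := pi) (B := setT)) => [|v]; last by rewrite inE.
  by apply: eq_bigl => P; rewrite inE.
rewrite card_parts [2 * #|K|]mulnC -sum_nat_const cardM big_distrr -!big_split.
apply: leq_sum => P _ /=; case: (boolP (P \in M)) => PM; first by have := part_le4 P; lia.
case: (leqP (s P) 2) => [|PB]; first by lia.
have := @z_unmerged P; rewrite !inE PB PM => /(_ isT).
have : s P <= z P + #|[set v in W | pi v == P]|; last by lia.
rewrite -cardsUI; apply: leq_trans (leq_addr _ _); apply: subset_leq_card.
apply/subsetP => v; rewrite !inE => vP; rewrite vP !andbT.
by rewrite /p (eqP vP) (negbTE PM) /= orbN.
Qed.

Lemma Y_le_M : #|Y| <= #|M|.
Proof. by apply: subset_leq_card; apply/subsetP => P; apply: merged_node. Qed.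

Hypothesis viol : r + #|~: (pi @: Z)| < #|K| + #|Y| \/ #|W| + #|~: (pi @: Z)| < #|Y|.

Lemma many_merged : r < #|M| + #|K|.
Proof.
rewrite ltnNge; apply/negP; move: leftover Y_le_M beyond_tight ltk.
by case: viol; clear; lia.
Qed.

Let X2r : #|X| < 2 * r.
Proof. by move: ltXS card_nodes many_merged beyond_tight; clear; lia. Qed.

(** The pair has at least as many common colours as the two single vertices, so all four see at
    least [2 * r] colours, against [X2r]. *)
Lemma zy_merged P : P \in Y -> 1 < z P -> False.
Proof.
move=> PY /card_gt1P[u [v []]]; rewrite !inE => /andP[uZ /eqP uP] /andP[vZ /eqP vP] nuv.
have [a [b [aP /mergeableP[nab pab _ dom _] abZ /(_ PY) abX]]] := pairP (merged_node PY).
have [|nua nub] := abZ u; first by rewrite inE.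
have [|nva nvb] := abZ v; first by rewrite inE.
have bP : pi b = P by rewrite -pab.
have := @card_union_pair2 u v a b pab;
  rewrite bP uP vP => /(_ erefl erefl nab nuv nua nub nva nvb).
have : #|L u :|: L v :|: (L a :&: L b)| <= #|X|.
  by apply: subset_leq_card; rewrite !subUset !single_sub ?inE.
have := dom u v; rewrite aP !inE !negb_or nua nub nva nvb => /(_ uP vP nuv isT isT).
by move: X2r; clear; lia.
Qed.

(** In a part of size 2, two single vertices have disjoint lists by [no_common] and would see
    [2 * r] colours; larger parts follow from the preceding bounds and [part_le4]. *)
Lemma zy_le P : z P + y P <= uphalf (s P).
Proof.
have := part_le4 P; have := part_gt0 crit P; have := z_le P; have := y_le P.
case: (boolP (P \in M)) => PM.
  have := z_merged PM; have : 2 < s P by have := subsetP MB P PM; rewrite inE.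
  rewrite /y; case: (boolP (P \in Y)) => PY; last first.
    by move: (z P) (s P) => a [|[|[|[|[|q]]]]] //=; clear; lia.
  have : z P <= 1 by rewrite leqNgt; apply/negP; apply: zy_merged.
  by move: (z P) (s P) => a [|[|[|[|[|q]]]]] //=; clear; lia.
case: (leqP (s P) 2) => [|PB]; last first.
  have := @z_unmerged P; rewrite !inE PB PM => /(_ isT).
  by move: PB; move: (z P) (y P) (s P) => a b [|[|[|[|[|q]]]]] //=; clear; lia.
rewrite leqn0 => s2 /eqP-> zs s0 _; rewrite addn0.
case: (leqP (z P) 1) => [|z2].
  by move: s0 zs; move: (z P) (s P) => a [|[|q]] //=; clear; lia.
have sz : s P = 2 by apply/eqP; rewrite eqn_leq s2 (leq_trans z2).
move/card_gt1P: z2 => [u [v []]]; rewrite !inE => /andP[uZ /eqP uP] /andP[vZ /eqP vP] nuv.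
have prtE : prt P = [set u; v].
  apply/esym/eqP; rewrite eqEcard cards2 nuv sz leqnn andbT; apply/subsetP => w.
  by rewrite !inE => /orP[] /eqP->; rewrite ?uP ?vP.
have := @two_single u v; rewrite !inE => /(_ uZ vZ).
suff -> : l u v = 0 by move: X2r; clear; lia.
apply/eqP; rewrite cards_eq0; apply/eqP/setP => c; rewrite !inE; apply/negP => /andP[cu cv].
apply: (no_common crit (P := P) (c := c)); first by rewrite sz.
move=> w wP; have : w \in [set u; v] by rewrite -prtE inE wP.
by rewrite !inE => /orP[] /eqP->.
Qed.

Lemma S_half : #|S| <= half_order.
Proof. by rewrite cardS cardZ cardY -big_split; apply: leq_sum => P _; apply: zy_le. Qed.

Let pair_bad P v : P \in Y -> v \in Z -> pi v = P -> exists a b,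
  [/\ pi a = P, mergeable Q a b & r + l a b <= #|X|].
Proof.
move=> PY vZ vP; have [a [b [aP ab abZ /(_ PY) abX]]] := pairP (merged_node PY).
exists a, b; split=> //; have [nva nvb] := abZ v vZ.
have [nab pab _ _ _] := mergeableP _ _ _ ab.
rewrite -(@card_union_pair v) -?pab ?aP //.
by apply: subset_leq_card; rewrite subUset abX single_sub.
Qed.

(** Pair and vertex would see at least [r + sigma >= half_order >= #|S|] colours. *)
Lemma strong_good P v : P \in Ms -> P \in Y -> v \in Z -> pi v != P.
Proof.
move=> PMs PY vZ; apply/eqP => vP;
  have [a [b [aP /mergeableP[_ _ _ _ best] lX]]] := pair_bad PY vZ vP.
have : sigma <= l a b.
  rewrite best ?aP ?inE ?PMs //; by have := subsetP Mstr P PMs; rewrite inE => /andP[].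
by move: lX ltXS S_half half_evens; rewrite /sigma; clear; lia.
Qed.

(** An odd part in [Ms] has size 3 and falls short of [zy_le] by 1. These losses give [#|S| <= r],
    so [S] contains no single vertex, and the merged pairs see their distinct colours [d P]. *)
Lemma S_le_strong : #|Ms| = sigma -> False.
Proof.
move=> cMs.
pose t P : nat := (P \in Ms) && odd (s P).
have zyt P : z P + y P + t P <= uphalf (s P).
  rewrite /t; case: (boolP (P \in Ms)) => PMs /=; last by rewrite addn0 zy_le.
  have PM := subsetP MsM P PMs; case: (boolP (odd _)) => os; last by rewrite addn0 zy_le.
  have s2 : 2 < s P by have := subsetP MB P PM; rewrite inE.
  have s3 : s P = 3.
    by have := part_le4 P; move: os s2; case: (s P) => [|[|[|[|[|q]]]]].
  have := z_merged PM; rewrite s3 /y; case: (boolP (P \in Y)) => PY /=; last by clear; lia.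
  suff -> : z P = 0 by [].
  apply/eqP; rewrite cards_eq0; apply/eqP/setP => v; rewrite inE [RHS]inE.
  by apply/negP => /andP[vZ vP]; have := strong_good PMs PY vZ; rewrite vP.
have : #|S| + \sum_P t P <= half_order.
  by rewrite cardS cardZ cardY -!big_split; apply: leq_sum => P _; apply: zyt.
have : sigma <= \sum_P t P + #|even_parts|.
  rewrite -cMs -!sum1_card [X in X <= _]big_mkcond [X in _ <= _ + X]big_mkcond -big_split.
  by apply: leq_sum => P _; rewrite /t !inE; case: (P \in Ms); case: odd.
have := half_evens => h1 h2 h3.
have Sr : #|S| <= r by move: h1 h2 h3; rewrite /sigma; clear; lia.
have Z0 : Z = set0.
  apply/setP => v; rewrite [RHS]inE; apply/negP => /single_sub/subset_leq_card.
  by rewrite Lr; move: ltXS Sr; clear; lia.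
have : #|Y| <= #|X|; last by move: ltXS; rewrite cardS Z0 cards0; clear; lia.
have dY : {in Y &, injective d}.
  by move=> P P' /merged_node PM /merged_node PM'; apply: dM.2.
rewrite -(card_in_imset dY); apply: subset_leq_card; apply/subsetP => c /imsetP[P PY ->].
apply/nbhP; exists (inr P); first by move: PY; rewrite inE.
by apply/bigcapP => v /eqP/node_inr[].
Qed.

(** If all strong parts are in [Ms], then [#|S| <= #|K| + #|M| <= #|X| + 1], so equality holds
    throughout. Hence the part in [E] has both its pair and a single vertex in [S], and these see
    too many colours. *)
Lemma violating_false : False.
Proof.
case: dicho => [/S_le_strong//|[MsE [ltst hE]]].
have nstr P u v : P \in big_parts -> P \notin Ms -> u \in Z -> v \in Z -> pi u = P ->
  pi v = P -> u != v -> False.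
  move=> PB PMs uZ vZ uP vP nuv; have lP : pairmax P < sigma.
    by rewrite ltnNge; apply: contraNN PMs; rewrite MsE [in _ \in strong_parts]inE PB.
  have := two_single uZ vZ; have := @leq_pairmax u v; rewrite uP vP => /(_ erefl nuv).
  by move: S_half half_evens ltXS lP; rewrite /sigma; clear; lia.
have z_unm P : P \notin M -> z P <= 1.
  move=> PM; case: (boolP (P \in big_parts)) => PB; last first.
    have := zy_le P; move: PB; rewrite inE -leqNgt.
    by move: (z P) (y P) (s P) => a b [|[|[|q]]] //=; clear; lia.
  rewrite leqNgt; apply/negP => /card_gt1P[u [v []]]; rewrite inE => /andP[uZ /eqP uP].
  rewrite inE => /andP[vZ /eqP vP]; apply: (@nstr P) => //.
  by apply: contraNN PM; apply: (subsetP MsM).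
(* If no part of [Y] meets [Z], then [#|Y| <= #|~: (pi @: Z)|], against [viol]. *)
case: (boolP (Y \subset ~: (pi @: Z))) => [/subset_leq_card|/subsetPn[P1 P1Y]].
  by move: ltk; case: viol; clear; lia.
rewrite inE negbK => /imsetP[v1 v1Z /esym v1P].
have P1M := merged_node P1Y.
have P1Ms : P1 \notin Ms.
  by apply/negP => PMs; have := strong_good PMs P1Y v1Z; rewrite v1P eqxx.
have XlamM : #|M| + #|K| <= #|X| + 1.
  have [a [b [aP /mergeableP[_ _ lab _ _] lX]]] := pair_bad P1Y v1Z v1P.
  have := @inM P1; rewrite inE P1Ms P1M => /(_ isT).
  move: lab lX; rewrite aP; move: beyond_tight; clear; lia.
have zy2 P : z P + y P <= 1 + (P \in M).
  case: (boolP (P \in M)) => PM.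
    have := zy_le P; have := part_le4 P;
      by move: (z P) (y P) (s P) => a b [|[|[|[|[|q]]]]] //=; clear; lia.
  by have := z_unm P PM; have := y_le P; rewrite (negbTE PM); clear; lia.
have sumM : #|K| + #|M| = \sum_P (1 + (P \in M)) by rewrite big_split sum1_card -cardM.
have SkM : #|S| <= #|K| + #|M|.
  by rewrite cardS cardZ cardY sumM -big_split; apply: leq_sum.
have [P0 P0E] : exists P0, P0 \in E.
  apply/set0Pn; apply/eqP => /hE MMs; by rewrite -MMs P1M in P1Ms.
have [P0Ms P0M] : P0 \notin Ms /\ P0 \in M by have := subsetP EM P0 P0E;
  rewrite inE => /andP[].
have P0B := subsetP MB P0 P0M.
have zy0 : z P0 + y P0 = 2.
  apply/eqP; rewrite eqn_leq; apply/andP; split; first by have := zy2 P0; rewrite P0M.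
  rewrite leqNgt; apply/negP => lt.
  have : #|S| < #|K| + #|M|; last by move: ltXS XlamM; clear; lia.
  rewrite cardS cardZ cardY sumM -big_split (bigD1 P0) //= [X in _ < X](bigD1 P0) //=.
  by rewrite P0M -addSn; apply: leq_add => //; apply: leq_sum.
have z1 : z P0 <= 1.
  rewrite leqNgt; apply/negP => /card_gt1P[u [v []]]; rewrite inE => /andP[uZ /eqP uP].
  by rewrite inE => /andP[vZ /eqP vP]; apply: (@nstr P0).
have P0Y : P0 \in Y by move: zy0 z1; rewrite /y; case: (P0 \in Y) => //; clear; lia.
have [v0' v0P] : exists v, v \in [set v in Z | pi v == P0].
  by apply/set0Pn; rewrite -card_gt0 -/(z P0); move: zy0; rewrite /y; case: (P0 \in Y);
    clear; lia.
move: v0P; rewrite inE => /andP[v0Z /eqP v0P].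
have [a [b [aP /mergeableP[_ _ _ _ best] lX]]] := pair_bad P0Y v0Z v0P.
have lab : l a b = pairmax P0 by rewrite -aP best // aP inE P0E orbT.
have n2M : 2 * #|M| + #|K| <= #|V|.
  rewrite card_parts [2 * _]mulnC addnC -[#|K|]sum1_card cardM big_distrl -big_split /=.
  apply: leq_sum => P _; have := part_gt0 crit P.
  case: (boolP (P \in M)) => [/(subsetP MB)|_]; first by rewrite inE; clear; lia.
  by clear; lia.
(* With [m = #|M| + #|K| - 1]: [r + pairmax P0 <= m <= 3 * pairmax P0] gives [3 * r <= 2 * m], but
   [n2M] gives [2 * m + 1 <= 3 * r]. *)
have := trimax_le3 P0B; have := @inM P0; rewrite inE P0Ms P0M => /(_ isT).
move: lX; rewrite lab; move: SkM ltXS XlamM n2M beyond_tight; clear; lia.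
Qed.

End Violating.

Lemma analysis_false : False.
Proof.
pose dn (x : V + K) := if x is inr P then d P else c0.
have inr2 x : 1 < #|node_class p x| -> exists2 P, P \in M & x = inr P.
  case: x => [v|P] x2; first by move: x2; rewrite ltnNge card_node_inl.
  exists P => //; have /card_gt0P[v] : 0 < #|node_class p (inr P)| by apply: ltnW.
  by rewrite inE => /eqP/node_inr[].
have dnL x : 1 < #|node_class p x| -> dn x \in node_list L p x.
  by move=> /inr2[P PM ->]; apply/bigcapP => v /eqP/node_inr[].
have dnI : {in [pred x | 1 < #|node_class p x|] &, injective dn}.
  move=> x y; rewrite !inE => /inr2[P PM ->] /inr2[P' PM' ->] /= e.
  by congr inr; apply: dM.2.
have [S [SD ltS]] := violator c0 crit node_pi dnL dnI.
rewrite /= -(singleE SD) (card_mergedE SD) => h.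
apply: (violating_false SD ltS); case: h; [|by left|by right].
by have := ex_single_miss SD ltS => /eqP.
Qed.

End Analysis.

Lemma beyond_false : False.
Proof.
have [Ms MsS cMs] := exists_subset_card (geq_minl #|strong_parts| sigma).
have SB : strong_parts \subset big_parts by apply/subsetP => P; rewrite inE => /andP[].
have [M [MsM MB outM inM]] := threshold (subset_trans MsS SB).
have [E [EM E1 Qs dich]] : exists E : {set K}, [/\ E \subset M :\: Ms, #|E| <= 1,
    #|Ms :|: E| <= sigma & #|Ms| = sigma \/ Ms = strong_parts /\ #|strong_parts| < sigma
      /\ (E = set0 -> M = Ms)].
  case: (leqP sigma #|strong_parts|) => h.
    exists set0; rewrite sub0set cards0 setU0 cMs (minn_idPr h); split=> //; by left.
  have eMs : Ms = strong_parts.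
    by apply/eqP; rewrite eqEcard MsS cMs (minn_idPl (ltnW h)) /=.
  have [e|[P0 P0M]] := set_0Vmem (M :\: Ms).
    exists set0; rewrite sub0set cards0 setU0 eMs (ltnW h); split=> //; right;
      split=> //; split=> // _.
    by rewrite -eMs; apply/eqP; rewrite eqEsubset MsM -setD_eq0 e eqxx.
  exists [set P0]; rewrite sub1set cards1; split=> //.
    by apply: leq_trans (leq_card_setU _ _).1 _; rewrite cards1 addn1 eMs.
  right; split=> //; split=> // e; by move: (set11 P0); rewrite e inE.
have EM' : E \subset M by apply: subset_trans EM (subsetDl _ _).
have [d dM] := merge_colours_sdr MsS MsM EM' MB E1 Qs inM.
exact: (analysis_false MsS MsM EM MB E1 outM inM dM dich).

Qed.

End Beyond.

(** * As many colours as parts *)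

Section Ohba.
Variables (V K C : finType) (c0 : C) (pi : V -> K) (L : V -> {set C}).
Hypothesis crit : critical pi L #|K|.
Local Notation Cs := (nbh L setT).
Hypothesis matchable : forall U : {set C}, U \subset Cs -> #|U| <= #|seen L U|.
Hypothesis fewC : #|Cs| < #|V|.
Let Lr := critical_list crit.
Let nkr := critical_order crit.

Local Notation prt P := [set v | pi v == P].
Local Notation s P := #|prt P|.

Definition sees c := [set v | c \in L v].
Definition gap := #|V| - #|Cs|.
Definition multi := [set P | 1 < s P].
Definition lone := [set v | pi v \notin multi].

Lemma list_sub v : L v \subset Cs. Proof. by apply: bigcup_sup. Qed.

Lemma lone_inj u v : u \in lone -> pi u = pi v -> u = v.
Proof.
rewrite !inE -leqNgt => /card_le1P/(_ u) + uv; rewrite inE eqxx => /(_ isT) e.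
by have := e v; rewrite !inE uv eqxx => /esym/eqP.
Qed.

Lemma card_lone : #|lone| + #|multi| = #|K|.
Proof.
rewrite -[RHS](cardsC multi) addnC; congr (_ + _).
rewrite (card_fibres (p := pi) (B := ~: multi)) => [|v]; last by rewrite !inE.
rewrite -sum1_card; apply: eq_bigr => P; rewrite !inE -leqNgt => s1.
apply/eqP; rewrite eqn_leq; apply/andP; split.
  by apply: leq_trans s1; apply: subset_leq_card; apply/subsetP => v;
    rewrite !inE => /andP[].
have [v vP] := critical_surj crit P; rewrite card_gt0; apply/set0Pn; exists v.
by rewrite !inE vP eqxx -leqNgt s1.
Qed.

(** * Matching the colours outside [J] *)

Section Spare.
Variable J : {set C}.
Hypotheses (JC : J \subset Cs) (cJ : #|J| = #|multi|).
Let B := Cs :\: J.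

(** Each list keeps at least [#|K| - #|multi| = #|lone|] colours outside [J]. *)
Lemma lone_sdr : exists t, sdr (fun v => L v :\: J) lone t.
Proof.
apply: (hall c0) => S SS; have [->|[v vS]] := set_0Vmem S; first by rewrite cards0.
have : #|L v :\: J| <= #|nbh (fun v => L v :\: J) S|.
  by apply: subset_leq_card; apply: (bigcup_sup v).
have := subset_leq_card SS; have := card_lone.
by rewrite cardsD Lr; have := subset_leq_card (subsetIr (L v) J); rewrite cJ; lia.
Qed.

Let v0 : V. Proof. by have /card_gt0P/sigW[v _] : 0 < #|V| by apply: leq_ltn_trans fewC.
  Qed.

(* A Mendelsohn-Dulmage argument: dummy colours seen by the vertices outside
   [lone] complete [B] to as many colours as there are vertices. *)
Lemma spare_matching : exists mu : C -> V, [/\ {in B, forall c, c \in L (mu c)},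
  {in B &, injective mu} & lone \subset mu @: B].
Proof.
have cB : #|B| <= #|Cs| by rewrite subset_leq_card ?subsetDl.
pose q := #|V| - #|B|.
pose R (x : C + 'I_q) := if x is inl c then sees c else ~: lone.
pose D := [set x : C + 'I_q | if x is inl c then c \in B else true].
have cD : #|D| = #|V|.
  rewrite card_sum_set.
  have -> : [set i | inl i \in D] = B by apply/setP => c; rewrite !inE.
  have -> : [set i | inr i \in D] = setT by apply/setP => c; rewrite !inE.
  by rewrite cardsT card_ord subnKC // ltnW // (leq_ltn_trans cB).
have [t [tL tI]] := lone_sdr.
have [S SD|f [fR fI]] := @hall _ _ v0 R D.
  pose S1 := [set c | inl c \in S]; pose S2 := [set i | inr i \in S].
  have S1B : S1 \subset B.
    by apply/subsetP => c; rewrite inE => /(subsetP SD); rewrite inE.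
  have sub : seen L S1 \subset nbh R S.
    apply/subsetP => v /seenP[c cv]; rewrite inE => cS; apply/nbhP; exists (inl c) => //.
    by rewrite inE.
  rewrite card_sum_set -/S1 -/S2; have [->|[i iS]] := set_0Vmem S2.
    rewrite cards0 addn0; apply: leq_trans (subset_leq_card sub); apply: matchable.
    by apply: subset_trans S1B (subsetDl _ _).
  have sub2 : ~: nbh R S \subset lone.
    rewrite -[lone]setCK setCS; apply/subsetP => v vl; apply/nbhP; exists (inr i) => //.
    by move: iS; rewrite inE.
  (* Once [S] contains a dummy, only vertices of [lone] are missed, and their representatives under
     [t] lie outside [S1]. *)
  have : #|~: nbh R S| <= #|B :\: S1|.
    have tI' : {in ~: nbh R S &, injective t}.
      by move=> x y /(subsetP sub2) xl /(subsetP sub2); apply: tI.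
    rewrite -(card_in_imset tI'); apply: subset_leq_card;
      apply/subsetP => c /imsetP[v vn ->].
    have := tL v (subsetP sub2 v vn); rewrite inE => /andP[tJ tv].
    rewrite !inE tJ (subsetP (list_sub v)) //= andbT; apply: contraTN vn => tS.
    by rewrite inE negbK; apply/nbhP; exists (inl (t v)); rewrite ?inE.
  rewrite cardsD (setIidPr S1B); have := cardsC (nbh R S); have := subset_leq_card S1B.
  by have := max_card S2; rewrite card_ord /q; move: fewC cB; clear; lia.
have fT : f @: D = setT.
  by apply/eqP; rewrite eqEcard subsetT cardsT (card_in_imset fI) cD leqnn.
exists (f \o inl); split=> [c cB'|c d cB' dB /= e|].
- by have := fR (inl c); rewrite [_ \in D]inE => /(_ cB'); rewrite inE.
- by have [] : inl c = inl d :> C + 'I_q by apply: fI => //; rewrite inE.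
apply/subsetP => v vl; have : v \in f @: D by rewrite fT inE.
case/imsetP => -[c|i] xD e; last by have := fR _ xD; rewrite -e inE vl.
by apply/imsetP; exists c => //; move: xD; rewrite inE.
Qed.

(** * Configurations and almost acceptable colourings *)

Section Configuration.
Variable mu : C -> V.
Hypotheses (muL : {in B, forall c, c \in L (mu c)}) (muI : {in B &, injective mu})
  (muT : lone \subset mu @: B).

(** Active colours are matched into parts of size at least 2. The remaining colours form the [pool],
    of size [#|K|]. *)
Definition active := [set c in B | mu c \notin lone].
Definition lone_colours := [set c in B | mu c \in lone].
Definition pool := J :|: lone_colours.

Lemma card_lone_colours : #|lone_colours| = #|lone|.
Proof.
have lB : lone_colours \subset B by apply/subsetP => c; rewrite inE => /andP[].
rewrite -(card_in_imset (sub_in2 (subsetP lB) muI)); apply: eq_card => v.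
apply/imsetP/idP => [[c]|vl]; first by rewrite inE => /andP[_ ?] ->.
by have /imsetP[c cB e] := subsetP muT v vl; exists c => //; rewrite inE cB -e.
Qed.

Lemma active_pool : active = Cs :\: pool.
Proof.
apply/setP => c; rewrite [LHS]inE !in_setD in_setU [c \in lone_colours]inE in_setD.
by case: (c \in J); case: (c \in Cs); case: (mu c \in lone).
Qed.

Lemma pool_sub : pool \subset Cs.
Proof.
rewrite subUset JC; apply/subsetP => c; rewrite inE => /andP[].
by rewrite inE => /andP[].
Qed.

Lemma card_pool : #|pool| = #|K|.
Proof.
rewrite cardsU cJ card_lone_colours; have -> : J :&: lone_colours = set0.
  by apply/setP => c; rewrite !inE; case: (c \in J).
by rewrite cards0 subn0 addnC card_lone.
Qed.

Lemma card_active : #|active| + #|K| + gap = #|V|.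
Proof.
rewrite active_pool cardsD (setIidPr pool_sub) card_pool /gap.
have := subset_leq_card pool_sub; rewrite card_pool; move: fewC; clear; lia.
Qed.

(* [g c] consists of a part and of the vertices in it coloured by [c]. *)
Implicit Types g : {ffun C -> K * {set V}}.
Definition gsize g := \sum_(c in active) #|(g c).2|.
Definition config g := [&& [forall c in active, [&& (g c).2 \subset prt (g c).1 :&: sees c,
    (g c).2 != set0 & (g c).1 \in multi]],
  [forall c in active, forall c' in active, (c != c') ==> [disjoint (g c).2 & (g c').2]] &
  gsize g <= #|active| + gap].

Lemma configP g : reflect [/\ {in active, forall c, [/\ (g c).2 \subset prt (g c).1,
  (g c).2 \subset sees c,
    (g c).2 != set0 & (g c).1 \in multi]},
  {in active &, forall c c', c != c' -> [disjoint (g c).2 & (g c').2]} &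
  gsize g <= #|active| + gap] (config g).
Proof.
apply: (iffP and3P) => [[/forall_inP h1 /forall_inP h2 h3]|[h1 h2 h3]]; split=> //.
- by move=> c /h1/and3P[]; rewrite subsetI => /andP[].
- by move=> c c' cA cA' ncc; have /forall_inP/(_ c' cA')/implyP := h2 c cA; apply.
- by apply/forall_inP => c /h1[h4 h5 h6 h7]; rewrite subsetI h4 h5 h6.
apply/forall_inP => c cA; apply/forall_inP => c' cA'; apply/implyP; exact: h2.
Qed.

Definition dom g := \bigcup_(c in active) (g c).2.
Definition rest g P := prt P :\: dom g.
Definition touched g := [set (g c).1 | c in active].
(** By [sum_rest], the excess of the uncoloured vertices in parts of size at least 2 over the
    colours of [J]. *)
Definition slack g := #|active| + gap - gsize g.
Definition common g P := pool :&: \bigcap_(v in rest g P) L v.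

Definition colour_at g v := odflt c0 [pick c in active | v \in (g c).2].

Lemma domP g v : reflect (exists2 c, c \in active & v \in (g c).2) (v \in dom g).
Proof. exact: bigcupP. Qed.

Lemma colour_atE g c v : config g -> c \in active -> v \in (g c).2 -> colour_at g v = c.
Proof.
case/configP => _ dj _ cA vc; rewrite /colour_at; case: pickP => [d /andP[dA vd]|/(_ c)] /=.
  apply/eqP; apply/idPn => ndc; have := disjointFr (dj d c dA cA ndc) vd.
  by rewrite vc.
by rewrite cA vc.
Qed.

Lemma card_dom g : config g -> #|dom g| = gsize g.
Proof.
move=> cg; rewrite (card_fibres (p := colour_at g) (B := active)) => [|v]; last first.
  by case/domP => c cA vc; rewrite (colour_atE cg cA vc).
apply: eq_bigr => c cA; apply: eq_card => v; rewrite inE.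
apply/andP/idP => [[/domP[d dA vd]]|vc]; first by rewrite (colour_atE cg dA vd) => /eqP <-.
by rewrite (colour_atE cg cA vc); split=> //; apply/domP; exists c.
Qed.

Lemma dom_multi g v : config g -> v \in dom g -> pi v \in multi.
Proof.
case/configP => h _ _ /domP[c cA vc]; have [/subsetP/(_ v vc)] := h c cA.
by rewrite inE => /eqP->.
Qed.

Definition lone_colour v := odflt c0 [pick c in lone_colours | mu c == v].

Lemma lone_colourP v : v \in lone ->
  lone_colour v \in lone_colours /\ mu (lone_colour v) = v.
Proof.
move=> vl; rewrite /lone_colour; case: pickP => [c /andP[cE /eqP]|] //=.
by have /imsetP[c cB e] := subsetP muT v vl => /(_ c); rewrite inE cB -e vl eqxx.
Qed.

(* An acceptable colouring except that a vertex may get a colour of [J] that is not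
   in its list, provided no other vertex gets it. *)
Definition almost (f : V -> C) := [/\ forall u v, f u = f v -> pi u = pi v,
  forall v, f v \in Cs,
  forall v, f v \in L v \/ f v \in J /\ (forall u, f u = f v -> u = v) &
  #|[set c | 1 < #|[set v | f v == c]|]| <= gap].

Lemma active_notJ c : c \in active -> c \notin J.
Proof. by rewrite inE => /andP[]; rewrite inE => /andP[]. Qed.

Lemma lone_colours_notJ c : c \in lone_colours -> c \notin J.
Proof. by rewrite inE => /andP[]; rewrite inE => /andP[]. Qed.

Lemma active_notpool c : c \in active -> c \notin pool.
Proof. by rewrite active_pool inE => /andP[]. Qed.

(* The uncoloured vertices of each part in [D] are merged and the remaining ones
   receive distinct colours of [J]. *)
Lemma almost_of_config g (D : {set K}) (dl : K -> C) : config g -> D \subset multi ->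
  #|D| <= slack g -> slack g <= \sum_(P in D) (#|rest g P| - 1) ->
  {in D, forall P, 0 < #|rest g P|} -> sdr (common g) D dl ->
  exists f, almost f.
Proof.
move=> cg DM Dle Dge D0 [dlC dlI]; have [gP gdj gle] := configP _ cg.
pose U := dl @: D.
have dlU P : P \in D -> dl P \in U by apply: imset_f.
have Upool : U \subset pool.
  by apply/subsetP => c /imsetP[P PD ->]; have := dlC P PD; rewrite inE => /andP[].
(* [left3] is merged. [left1], and the vertices [left2] of [lone] whose matched colour went to a
   merged group, must share [J :\: U]. *)
pose left1 := [set v | [&& pi v \in multi, v \notin dom g & pi v \notin D]].
pose left2 := [set v in lone | lone_colour v \in U].
pose left3 := [set v | (v \notin dom g) && (pi v \in D)].
have c3 : slack g + #|D| <= #|left3|.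
  rewrite (card_fibres (p := pi) (B := D)) => [|v]; last by rewrite inE => /andP[].
  apply: leq_trans (_ : \sum_(P in D) (#|rest g P| - 1 + 1) <= _).
    by rewrite big_split sum1_card leq_add2r.
  apply: leq_sum => P PD; rewrite subnK ?D0 //; apply: subset_leq_card.
  by apply/subsetP => v; rewrite !inE => /andP[-> /eqP->]; rewrite PD eqxx.
have c1 : #|left1| + #|left3| + #|lone| + gsize g = #|V|.
  have e1 : #|~: lone :\: dom g| = #|left1| + #|left3|.
    rewrite -(cardsID [set v | pi v \in D] (_ :\: _)) [RHS]addnC.
    congr (_ + _); apply: eq_card => v; last first.
      by rewrite !inE negbK; case: (pi v \in D); case: (v \in dom g); rewrite ?andbF ?andbT.
    rewrite !inE negbK; case: (boolP (pi v \in D)) => vD; rewrite ?andbF // ?andbT.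
    by have := subsetP DM _ vD; rewrite inE => ->; rewrite andbT.
  have e2 : ~: lone :&: dom g = dom g.
    apply/setIidPr/subsetP => v /(dom_multi cg); rewrite !inE negbK //.
  have := cardsC lone; have := cardsID (dom g) (~: lone); rewrite e1 e2 (card_dom cg).
  by clear; lia.
have c2 : #|left2| <= #|U :&: lone_colours|.
  have lcI : {in left2 &, injective lone_colour}.
    move=> u v; rewrite [u \in _]inE [v \in _]inE => /andP[ul _] /andP[vl _] e.
    by have := (lone_colourP ul).2; rewrite e (lone_colourP vl).2.
  rewrite -(card_in_imset lcI); apply: subset_leq_card; apply/subsetP => c /imsetP[v].
  by rewrite inE => /andP[vl vU] ->; rewrite inE vU (lone_colourP vl).1.
have cU : #|U :&: J| + #|U :&: lone_colours| <= #|D|.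
  apply: leq_trans (leq_imset_card dl D); rewrite -/U -cardsUI.
  have -> : U :&: J :&: (U :&: lone_colours) = set0.
    by apply/setP => c; rewrite !inE; case: (c \in J) => //=; rewrite !andbF.
  by rewrite cards0 addn0 subset_leq_card // subUset !subsetIl.
(* [left1] has at most [#|multi| - #|D|] vertices, and [left2] is paid for by the colours of [U]
   outside [J]. *)
pose lf := left1 :|: left2.
have [h [hU hI]] : exists h, sdr (fun=> J :\: U) lf h.
  apply: (hall c0) => S SL; have [->|[v vS]] := set_0Vmem S; first by rewrite cards0.
  apply: leq_trans (_ : #|J :\: U| <= _); last first.
    by apply: subset_leq_card; apply: (bigcup_sup v).
  apply: leq_trans (subset_leq_card SL) _; apply: leq_trans (leq_card_setU _ _).1 _.
  move: c1 c2 c3 cU gle card_active card_lone.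
  by rewrite cardsD cJ [J :&: U]setIC /slack; clear; lia.
pose f v := if v \in dom g then colour_at g v else if v \in lf then h v else
  if v \in lone then lone_colour v else dl (pi v).
have fP v : [\/ f v \in active /\ v \in (g (f v)).2,
   [/\ f v \in J, f v \notin U, v \in lf & f v = h v],
   [/\ f v \in lone_colours, f v \notin U & mu (f v) = v] |
   [/\ pi v \in D, f v = dl (pi v) & v \in rest g (pi v)]].
  rewrite /f; case: (boolP (v \in dom g)) => vd.
    by case/domP: vd => c cA vc; rewrite (colour_atE cg cA vc); constructor 1.
  case: (boolP (v \in lf)) => vlf.
    by have := hU v vlf; rewrite inE => /andP[? ?]; constructor 2.
  case: (boolP (v \in lone)) => vl.
    constructor 3; have [? ?] := lone_colourP vl; split=> //.
    by apply: contraNN vlf => lU; rewrite inE [X in _ || X]inE vl lU orbT.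
  constructor 4; split=> //; last by rewrite !inE eqxx vd.
  apply: contraNT vlf => nD; rewrite inE [X in X || _]inE vd nD andbT /=.
  by move: vl; rewrite inE negbK => ->.
have fJ v : f v \in J -> f v \notin U -> v \in lf /\ f v = h v.
  case: (fP v) => [[/active_notJ/negbTE->]|[_ _ ? ?]|[/lone_colours_notJ/negbTE->]|[vD ->
    _ _]] //.
  by rewrite dlU.
have fU v : f v \in U -> [/\ pi v \in D, f v = dl (pi v) & v \in rest g (pi v)].
  case: (fP v) => [[/active_notpool fA _] /(subsetP Upool)|[_ /negbTE->]|[_ /negbTE->]|] //.
  by rewrite (negbTE fA).
have fA v : f v \in active -> v \in (g (f v)).2.
  case: (fP v) => [[]//|[fj _ _ _] /active_notJ|[fl _ _] /active_notpool|[vD ->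
    _] /active_notpool].
  - by rewrite fj.
  - by rewrite inE fl orbT.
  - by rewrite (subsetP Upool) ?dlU.
have fE v : f v \in lone_colours -> f v \notin U -> mu (f v) = v.
  case: (fP v) => [[/active_notpool fA' _] fl|[fj _ _ _] /lone_colours_notJ|[_ _ ->]|[vD
    -> _] _] //.
  - by move: fA'; rewrite inE fl orbT.
  - by rewrite fj.
  - by rewrite dlU.
have fJ2 u v : f v \in J -> f v \notin U -> f u = f v -> u = v.
  move=> fj fn e; have [vl vh] := fJ v fj fn; rewrite -e in fj fn.
  by have [ul uh] := fJ u fj fn; apply: hI => //; rewrite -uh -vh.
exists f; split.
- move=> u v e; case: (fP u) => [[fa fu]|[fj fn _ _]|[fl fn fm]|[uD fd ur]].
  + have := fA v; rewrite -e => /(_ fa) fv; have [sP _ _ _] := gP _ fa.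
    by have := subsetP sP _ fu; have := subsetP sP _ fv; rewrite !inE => /eqP-> /eqP->.
  + by rewrite (fJ2 v u fj fn (esym e)).
  + by rewrite -fm e fE // -e.
  + have [vD vd _] : [/\ pi v \in D, f v = dl (pi v) & v \in rest g (pi v)].
      by apply: fU; rewrite -e fd dlU.
    by apply: dlI => //; rewrite -fd -vd.
- move=> v; case: (fP v) => [[fa _]|[fj _ _ _]|[fl _ _]|[vD -> _]].
  + by move: fa; rewrite active_pool inE => /andP[].
  + exact: (subsetP JC).
  + by apply: (subsetP pool_sub); rewrite inE fl orbT.
  + by apply: (subsetP pool_sub); apply: (subsetP Upool); apply: dlU.
- move=> v; case: (fP v) => [[fa fv]|[fj fn _ _]|[fl _ fm]|[vD -> vr]].
  + by left; have [_ sL _ _] := gP _ fa; have := subsetP sL _ fv; rewrite inE.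
  + by right; split=> // u; apply: fJ2.
  + by left; move: fl; rewrite inE => /andP[/muL]; rewrite fm.
  + by left; have := dlC _ vD; rewrite inE => /andP[_ /bigcapP]; apply.
(* At most [gsize g - #|active|] active colours repeat; adding [#|D| <= slack g] for [U] gives
   [gap]. *)
have sub : [set c | 1 < #|[set v | f v == c]|] \subset [set c in active | 1 < #|(g c).2|]
  :|: U.
  apply/subsetP => c; rewrite in_set => c2'; rewrite in_setU in_set.
  case: (boolP (c \in U)) => cU'; rewrite ?orbT // orbF.
  have [u [v [uc vc nuv]]] : exists u v, [/\ f u = c, f v = c & u != v].
    by have /card_gt1P[u [v []]] := c2'; rewrite !inE => /eqP uc /eqP vc nuv; exists u, v.
  case: (boolP (c \in active)) => cA /=.
    apply: (leq_trans c2'); apply: subset_leq_card; apply/subsetP => w;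
      rewrite inE => /eqP wc.
    by have := fA w; rewrite wc; apply.
  case/eqP: nuv; case: (fP u); rewrite uc.
  - by move=> [ca _]; rewrite ca in cA.
  - by move=> [fj fn _ _]; apply/esym/fJ2; rewrite ?uc ?vc.
  - by move=> [fl fn fm]; rewrite -fm -[RHS]fE ?vc.
  - by move=> [uD cd _]; rewrite cd dlU in cU'.
apply: leq_trans (subset_leq_card sub) _; apply: leq_trans (leq_card_setU _ _).1 _.
have : #|[set c in active | 1 < #|(g c).2|]| + #|active| <= gsize g.
  rewrite -!sum1_card /gsize [X in X + _ <= _]big_mkcond [X in _ + X <= _]big_mkcond [X
    in _ <= X]big_mkcond.
  rewrite -big_split; apply: leq_sum => c _; rewrite in_set.
  case: (boolP (c \in active)) => //= cA; have [_ _ + _] := gP c cA; rewrite -card_gt0.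
  by case: (ltnP 1) => //=; rewrite addn1.
have := leq_imset_card dl D; move: Dle gle; rewrite /slack -/U; clear; lia.
Qed.

Lemma gsize_gt0 g c : config g -> c \in active -> 0 < #|(g c).2|.
Proof. by case/configP => h _ _ cA; rewrite card_gt0; have [] := h c cA. Qed.

Lemma ex_config : exists g, config g.
Proof.
exists [ffun c => (pi (mu c), [set mu c])]; apply/configP; split=> [c cA|c c' cA cA' ncc|].
- rewrite ffunE /= !sub1set !inE eqxx -card_gt0 cards1.
  have := cA; rewrite [c \in active]inE [mu c \in lone]inE negbK => /andP[cB].
  by rewrite inE => h; rewrite muL.
- rewrite !ffunE /= disjoints1 inE; apply: contraNN ncc => /eqP e; apply/eqP/muI => //.
    by move: cA; rewrite inE => /andP[].
  by move: cA'; rewrite inE => /andP[].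
rewrite /gsize (eq_bigr (fun=> 1)) ?sum1_card ?leq_addr // => c _.
by rewrite ffunE cards1.
Qed.

Definition recolour g c x : {ffun C ->
  K * {set V}} := [ffun d => if d == c then x else g d].

Lemma gsize_recolour g c P (Y : {set V}) : c \in active ->
  gsize (recolour g c (P, Y)) + #|(g c).2| = gsize g + #|Y|.
Proof.
move=> cA; rewrite /gsize (bigD1 c) //= [in RHS](bigD1 c) //= ffunE eqxx /=.
rewrite (eq_bigr (fun d => #|(g d).2|)) => [|d /andP[_ /negbTE nd]];
  last by rewrite ffunE nd.
by rewrite addnC [#|Y| + _]addnC addnA.
Qed.

Lemma config_recolour g c P (Y : {set V}) : config g -> c \in active -> P \in multi ->
  Y \subset prt P -> Y \subset sees c -> Y != set0 ->
  (forall d, d \in active -> d != c -> [disjoint Y & (g d).2]) ->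
  gsize (recolour g c (P, Y)) <= #|active| + gap -> config (recolour g c (P, Y)).
Proof.
case/configP => h1 h2 h3 cA PM YP Yc Y0 Ydj le; apply/configP;
  split=> // [d dA|d d' dA dA' nd].
  by rewrite ffunE; case: eqP => [->|_] //=; apply: h1.
rewrite !ffunE; case: (eqVneq d c) => [e|nc]; case: (eqVneq d' c) => [e'|nc'] //=.
- by rewrite e e' eqxx in nd.
- exact: Ydj.
- by rewrite disjoint_sym; apply: Ydj.
- exact: h2.
Qed.

Lemma rest_dj g P d : d \in active -> [disjoint rest g P & (g d).2].
Proof.
move=> dA; apply/pred0P => v /=; apply/negP => /andP[]; rewrite inE => /andP[+ _] vd.
by case/negP; apply/domP; exists d.
Qed.

Lemma sum_active_pool (F : C -> nat) : \sum_(c in Cs) F c = \sum_(c in active) F c +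
  \sum_(c in pool) F c.
Proof.
rewrite (bigID (mem pool)) /= addnC; congr (_ + _); apply: eq_bigl => c.
  by rewrite active_pool in_setD andbC.
by apply/andP/idP => [[]//|cp]; split=> //; apply: (subsetP pool_sub).
Qed.

(** Double counting over [rest g P]: a pool colour that is not common misses one of its vertices,
    and the pool has [#|K|] colours. *)
Lemma count_common g P : 0 < #|rest g P| ->
  #|K| <= \sum_(c in active) #|sees c :&: rest g P| + #|common g P|.
Proof.
move=> r0.
have e : #|K| * #|rest g P| = \sum_(c in Cs) #|sees c :&: rest g P|.
  rewrite mulnC -sum_nat_const.
  rewrite (eq_bigr (fun v => \sum_(c in Cs | c \in L v) 1)) => [|v _]; last first.
    rewrite -(Lr v) -sum1_card; apply: eq_bigl => c.
    by case: (boolP (c \in L v)) => cv; rewrite ?andbF // andbT (subsetP (list_sub v)).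
  rewrite (exchange_big_dep (mem Cs)) /=; last by move=> v c _ /andP[].
  apply: eq_bigr => c cC; rewrite -[RHS]sum1_card; apply: eq_bigl => v.
  by rewrite cC in_setI [v \in sees c]in_set andbC.
have h : \sum_(c in pool) #|sees c :&: rest g P| <= #|K| * (#|rest g P| - 1) + #|common g
  P|.
  rewrite -card_pool -sum_nat_const -[#|common g P|]sum1_card.
  have -> : \sum_(c in common g P) 1 = \sum_(c in pool) (c \in \bigcap_(v in rest g P) L v).
    by rewrite big_mkcond [RHS]big_mkcond; apply: eq_bigr => c _; rewrite in_setI;
      case: (c \in pool); case: (c \in _).
  rewrite -big_split; apply: leq_sum => c _ /=.
  case: (boolP (c \in _)) => cc.
    by rewrite subnK //; apply: subset_leq_card; apply: subsetIr.
  rewrite addn0 subn1 -ltnS prednK //; apply: proper_card; apply/properP; split;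
    first exact: subsetIr.
  have /exists_inP[v vr cv] : [exists v in rest g P, c \notin L v].
    by apply: contraNT cc => /exists_inPn hh; apply/bigcapP => v /hh; rewrite negbK.
  by exists v => //; rewrite inE negb_and inE cv.
move: e h; rewrite sum_active_pool mulnBr muln1.
have : #|K| <= #|K| * #|rest g P| by rewrite leq_pmulr.
by clear; lia.
Qed.

Definition maximal g := config g /\ forall g', config g' -> gsize g' <= gsize g.

(** Otherwise [c] could be moved to [P] with one vertex more; positive slack leaves room for it. *)
Lemma maximal_other g P c : maximal g -> 0 < slack g -> P \in multi -> c \in active ->
  #|sees c :&: rest g P| <= #|(g c).2|.
Proof.
move=> [cg gmax] sl PM cA; rewrite leqNgt; apply/negP => lt.
have [Y YS cY] := exists_subset_card lt.
have := gsize_recolour g P Y cA; rewrite cY => e.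
have : gsize (recolour g c (P, Y)) <= gsize g; last by move: e; clear; lia.
apply: gmax; apply: config_recolour => //.
- by apply: subset_trans YS _; rewrite subIset // subsetDl orbT.
- by apply: subset_trans YS (subsetIl _ _).
- by rewrite -card_gt0 cY.
- move=> d dA _; apply: disjointWl (rest_dj g P dA).
  by apply: subset_trans YS (subsetIr _ _).
- by move: e sl; rewrite /slack; clear; lia.
Qed.

(** Such a vertex could join the class of [c]. *)
Lemma maximal_same g c : maximal g -> 0 < slack g -> c \in active ->
  sees c :&: rest g (g c).1 = set0.
Proof.
move=> [cg gmax] sl cA; apply/setP => v; rewrite [RHS]inE; apply/negP.
rewrite inE => /andP[vc vr]; have [h1 h2 _] := configP _ cg; have [s1 s2 s3 s4] := h1 c cA.
have vY : v \notin (g c).2 by rewrite (disjointFr (rest_dj g _ cA) vr).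
have := gsize_recolour g (g c).1 (v |: (g c).2) cA; rewrite cardsU1 vY => e.
have : gsize (recolour g c ((g c).1, v |: (g c).2)) <= gsize g; last by move: e; clear; lia.
apply: gmax; apply: config_recolour => //.
- by rewrite subUset s1 sub1set andbT; move: vr; rewrite in_setD => /andP[].
- by rewrite subUset s2 sub1set andbT.
- by apply/set0Pn; exists v; rewrite inE set11.
- move=> d dA nd; apply/pred0P => w /=; rewrite in_setU1.
  apply/negP => /andP[/orP[/eqP->|wY] wd].
    by rewrite (disjointFr (rest_dj g _ dA) vr) in wd.
  by have := h2 c d cA dA; rewrite eq_sym nd => /(_ isT) dj;
    rewrite (disjointFr dj wY) in wd.
- by move: e sl; rewrite /slack; clear; lia.
Qed.

(** In [count_common] the active sum is below [gsize g], since a colour placed in [P] contributes 0.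
    With [#|V| <= 2 * #|K| + 1] this leaves [slack g] common colours. *)
Lemma touched_common g P : maximal g -> 0 < slack g -> P \in touched g -> 0 < #|rest g P| ->
  slack g <= #|common g P|.
Proof.
move=> mg sl /imsetP[c cA e] r0; have := count_common r0.
have PM : P \in multi by have [h _ _] := configP _ mg.1; rewrite e; have [] := h c cA.
have : \sum_(d in active) #|sees d :&: rest g P| + 1 <= gsize g.
  rewrite /gsize (bigD1 c) //= [X in _ <= X](bigD1 c) //= e maximal_same // cards0 add0n
    addnC.
  apply: leq_add; first exact: (gsize_gt0 mg.1).
  by apply: leq_sum => d /andP[dA _]; apply: maximal_other => //; rewrite -e.
move: card_active nkr; rewrite /slack; clear; lia.
Qed.

Lemma sum_rest g : config g -> \sum_(P in multi) #|rest g P| = #|multi| + slack g.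
Proof.
move=> cg; have [_ _ le] := configP _ cg.
have -> : \sum_(P in multi) #|rest g P| = #|~: lone :\: dom g|.
  rewrite (card_fibres (p := pi) (B := multi)) => [|v]; last first.
    by rewrite in_setD in_setC [v \in lone]in_set negbK => /andP[].
  apply: eq_bigr => P PM; apply: eq_card => v.
  rewrite in_setD in_set [RHS]in_set in_setD in_setC [v \in lone]in_set negbK andbC.
  by case: eqP => [->|]; rewrite ?andbF // PM !andbT.
have e2 : ~: lone :&: dom g = dom g.
  by apply/setIidPr/subsetP => v /(dom_multi cg); rewrite in_setC [v \in lone]in_set negbK.
have := cardsC lone; have := cardsID (dom g) (~: lone); rewrite e2 (card_dom cg).
move: card_lone card_active le; rewrite /slack; clear; lia.
Qed.

Lemma almost_of_maximal g (D : {set K}) : maximal g -> D \subset multi ->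
  {in D, forall P, P \in touched g /\ 0 < #|rest g P|} -> #|D| <= slack g ->
  slack g <= \sum_(P in D) (#|rest g P| - 1) -> exists f, almost f.
Proof.
move=> mg DM Dt Dle Dge.
have [dl dlP] : exists dl, sdr (common g) D dl.
  apply: (hall c0) => S SD; have [->|[P PS]] := set_0Vmem S; first by rewrite cards0.
  have PD := subsetP SD P PS; have [Pt P0] := Dt P PD.
  apply: leq_trans (subset_leq_card SD) _; apply: (leq_trans Dle).
  have sl : 0 < slack g by apply: (leq_trans _ Dle); apply/card_gt0P; exists P.
  apply: leq_trans (touched_common mg sl Pt P0) _.
  by apply: subset_leq_card; apply: (bigcup_sup P).
by apply: (almost_of_config mg.1 DM Dle Dge _ dlP) => P /Dt[].
Qed.

Lemma untouched_rest g P : config g -> P \notin touched g -> rest g P = prt P.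
Proof.
move=> cg nt; apply/setDidPl; apply/pred0P => v /=; apply/negP => /andP[vP /domP[c cA vc]].
case/negP: nt; apply/imsetP; exists c => //; have [h _ _] := configP _ cg.
have [/subsetP/(_ v vc)] := h c cA; move: vP; rewrite !in_set => /eqP-> /eqP.
by [].
Qed.

Lemma no_common_multi P c : P \in multi -> ~~ (prt P \subset sees c).
Proof.
rewrite in_set => PM; apply/negP => /subsetP sP.
apply: (no_common crit (P := P) (c := c) PM) => v vP.
by have := sP v; rewrite !in_set vP => /(_ (eqxx _)).
Qed.

(* Moving a colour class of [g] to the untouched part [P0] gives another maximal
   configuration, hence every touched part carries a single colour; then all classes
   have size [s P0 - 1 = 1], which makes the touched parts too numerous. *)
Lemma exceptional_false g P0 : maximal g ->
  (forall g', config g' -> gsize g' = gsize g -> #|touched g'| <= #|touched g|) ->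
  0 < slack g -> P0 \in multi -> P0 \notin touched g ->
  (forall g' P, maximal g' -> slack g' = 1 -> P \in multi -> P \in touched g' ->
    #|rest g' P| <= 1) ->
  False.
Proof.
move=> mg tmax sl PM nt nice; have cg := mg.1; have [gP gdj gle] := configP _ cg.
have rP := untouched_rest cg nt.
have s2 : 1 < s P0 by move: PM; rewrite in_set.
have com0 : common g P0 = set0.
  apply/setP => c; rewrite [RHS]in_set0; apply/negP; rewrite in_setI => /andP[_ /bigcapP h].
  case/negP: (no_common_multi c PM); apply/subsetP => v vP; rewrite in_set; apply: h.
  by rewrite rP.
have ksum : #|K| <= \sum_(c in active) #|sees c :&: prt P0|.
  by have := @count_common g P0; rewrite com0 cards0 addn0 rP; apply; apply: ltnW.
have ole c : c \in active -> #|sees c :&: prt P0| <= #|(g c).2|.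
  by move=> cA; rewrite -rP; apply: maximal_other.
have sumle : \sum_(c in active) #|sees c :&: prt P0| <= gsize g by apply: leq_sum.
(* [#|K| <= gsize g], while [gsize g + slack g <= #|K| + 1]. *)
have [sl1 gk] : slack g = 1 /\ gsize g = #|K|.
  by move: ksum sumle sl card_active nkr gle; rewrite /slack; clear; lia.
have oeq c : c \in active -> #|sees c :&: prt P0| = #|(g c).2|.
  move=> cA; apply/eqP; rewrite eqn_leq ole //= leqNgt; apply/negP => lt.
  have : \sum_(c in active) #|sees c :&: prt P0| < gsize g; last by move: ksum gk; clear;
    lia.
  rewrite /gsize (bigD1 c) //= [X in _ < X](bigD1 c) //= -addSn; apply: leq_add => //.
  by apply: leq_sum => d /andP[dA _]; apply: ole.
pose mv c := recolour g c (P0, sees c :&: prt P0).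
have mvP c : c \in active -> [/\ config (mv c),
  gsize (mv c) = gsize g & P0 \in touched (mv c)].
  move=> cA; have es : gsize (mv c) = gsize g.
    by have := gsize_recolour g P0 (sees c :&: prt P0) cA; rewrite (oeq c cA) => /addIn.
  split=> //; last by apply/imsetP; exists c; rewrite // ffunE eqxx.
  apply: config_recolour => //; rewrite ?subsetIl ?subsetIr //.
  - by rewrite -card_gt0 oeq ?gsize_gt0.
  - move=> d dA _; apply: disjointWl (rest_dj g P0 dA); by rewrite rP subsetIr.
  - by rewrite -/(mv c) es.
(* If [c] and [d] shared a part, moving [c] to [P0] would increase the number of touched parts. *)
have tinj : {in active &, injective (fun c => (g c).1)}.
  move=> c d cA dA e; apply/eqP; apply/idPn => ncd; have [cm em tm] := mvP c cA.
  have := tmax _ cm em; rewrite leqNgt => /negP; apply; apply: proper_card.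
  apply/properP; split; last by exists P0.
  apply/subsetP => P /imsetP[x xA ->]; apply/imsetP; case: (eqVneq x c) => [->|nx].
    by exists d => //; rewrite ffunE eq_sym (negbTE ncd).
  by exists x => //; rewrite ffunE (negbTE nx).
have mvmax c : c \in active -> maximal (mv c).
  by move=> cA; have [cm em _] := mvP c cA; split=> // g' /mg.2; rewrite em.
have sq c : c \in active -> s P0 = #|(g c).2|.+1.
  move=> cA; have [cm em tm] := mvP c cA.
  have := nice _ P0 (mvmax c cA); rewrite /slack em -/(slack g) sl1 => /(_ erefl PM tm).
  have -> : rest (mv c) P0 = prt P0 :\: sees c.
    apply/setP => v; rewrite /rest !in_setD; case: (boolP (v \in prt P0)) => vP;
      rewrite ?andbF // !andbT.
    congr (~~ _); apply/domP/idP => [[d dA]|vc]; last first.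
      by exists c; rewrite // ffunE eqxx in_setI vc.
    rewrite ffunE; case: eqP => [_|_]; first by rewrite in_setI => /andP[].
    by rewrite -rP in vP; rewrite (disjointFr (rest_dj g P0 dA) vP).
  have := no_common_multi c PM; rewrite -setD_eq0 -cards_eq0.
  have := cardsID (sees c) (prt P0); rewrite setIC (oeq c cA).
  by case: #|prt P0 :\: sees c| => [|[|q]] //; rewrite addn1.
have rest1 P : P \in multi -> 0 < #|rest g P|.
  move=> PM'; case: (boolP (P \in touched g)) => [/imsetP[c cA e]|nt']; last first.
    by rewrite untouched_rest //; move: PM'; rewrite in_set; apply: ltnW.
  rewrite card_gt0; apply/eqP => r0; case/negP: (no_common_multi c PM');
    apply/subsetP => v vP.
  have : v \in dom g by apply/idPn => nv; move/setP/(_ v): r0;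
    rewrite in_setD vP nv in_set0.
  case/domP => d dA vd; have [sP sL _ _] := gP d dA.
  have := subsetP sP v vd; move: (vP); rewrite !in_set => /eqP-> /eqP;
    rewrite e => /(tinj _ _ cA dA) ecd.
  by rewrite ecd; have := subsetP sL v vd; rewrite in_set.
(* [P0] is wholly uncoloured and every other part of [multi] has an uncoloured vertex, while the
   excess over one per part is 1. *)
have sP0 : s P0 = 2.
  apply/eqP; rewrite eqn_leq s2 andbT.
  have := sum_rest cg; rewrite sl1 (bigD1 P0) //= rP.
  have : \sum_(P in multi | P != P0) 1 <= \sum_(P in multi | P != P0) #|rest g P|.
    by apply: leq_sum => P /andP[PM' _]; apply: rest1.
  rewrite [X in X <= _](_ : _ = #|multi|.-1); last first.
    rewrite (cardsD1 P0 multi) PM /= -sum1_card; apply: eq_bigl => P.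
    by rewrite in_setD1 andbC.
  have : 0 < #|multi| by apply/card_gt0P; exists P0.
  clear; lia.
have ga : gsize g = #|active|.
  by rewrite -sum1_card; apply: eq_bigr => c cA; have := sq c cA; rewrite sP0 => -[].
have : #|touched g| < #|multi|.
  apply: proper_card; apply/properP; split; last by exists P0.
  by apply/subsetP => P /imsetP[c cA ->]; have [] := gP c cA.
rewrite card_in_imset // -ga gk; have := card_lone; clear; lia.
Qed.

Lemma ex_almost : exists f, almost f.
Proof.
have [g0 cg0] := ex_config.
(* Lexicographic maximum: [gsize] first, then the number of touched parts. *)
pose meas g := gsize g * #|K|.+1 + #|touched g|.
case: (arg_maxnP meas cg0) => g cg gmax.
have mg : maximal g.
  split=> // g' cg'; have : meas g' <= meas g := gmax g' cg'.
  rewrite /meas => h; rewrite leqNgt; apply/negP => lt.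
  have := leq_mul lt (leqnn #|K|.+1); have := max_card (touched g); rewrite mulSn.
  by move: h; clear; lia.
have tmax g' : config g' -> gsize g' = gsize g -> #|touched g'| <= #|touched g|.
  move=> cg' e; have : meas g' <= meas g := gmax g' cg'.
  by rewrite /meas e leq_add2l.
have single g' P : maximal g' -> slack g' = 1 -> P \in multi -> P \in touched g' ->
    1 < #|rest g' P| -> exists f, almost f.
  move=> mg' sl PM Pt r2; apply: (@almost_of_maximal g' [set P]);
    rewrite ?sub1set ?cards1 ?sl ?big_set1 ?subn_gt0 //.
  by move=> P'; rewrite in_set1 => /eqP->; split=> //; apply: ltnW.
pose heavy := [set P in multi | 1 < #|rest g P|].
have hM : heavy \subset multi by apply/subsetP => P; rewrite in_set => /andP[].
case: (posnP (slack g)) => sl.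
  by apply: (@almost_of_maximal g set0); rewrite ?sub0set ?cards0 ?sl // => P;
    rewrite in_set0.
(* If all heavy parts are touched, merging up to [slack g] of them absorbs the slack. *)
case: (boolP (heavy \subset touched g)) => [ht|/subsetPn[P0 P0h P0t]].
  have [D Dh cD] := exists_subset_card (geq_minl #|heavy| (slack g)).
  apply: (@almost_of_maximal g D) => //.
  - exact: subset_trans Dh hM.
  - move=> P /(subsetP Dh) Ph; split; first exact: (subsetP ht).
    by move: Ph; rewrite in_set => /andP[_ /ltnW].
  - by rewrite cD geq_minr.
  case: (leqP (slack g) #|heavy|) => hs.
    apply: leq_trans (_ : \sum_(P in D) 1 <= _);
      first by rewrite sum1_card cD (minn_idPr hs).
    by apply: leq_sum => P /(subsetP Dh); rewrite in_set => /andP[_]; rewrite subn_gt0.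
  have -> : D = heavy by apply/eqP; rewrite eqEcard Dh cD (minn_idPl (ltnW hs)) /=.
  have := sum_rest cg.
  have : \sum_(P in multi) #|rest g P| <= \sum_(P in multi) (1 + if P \in heavy then
    #|rest g P| - 1 else 0).
    apply: leq_sum => P PM; rewrite in_set PM /=; case: ifP;
      last by rewrite addn0 ltnNge; case: leqP.
    by clear; lia.
  rewrite big_split sum1_card -big_mkcondr /=.
  rewrite [X in _ <= _ + X](eq_bigl (fun P => P \in heavy)) => [|P]; last first.
    by apply/andP/idP => [[]//|Ph]; split=> //; apply: (subsetP hM).
  by clear; lia.
case: (boolP [exists g' : {ffun C ->
  K * {set V}}, exists P, [&& config g', gsize g' == gsize g,
    slack g' == 1, P \in multi, P \in touched g' & 1 < #|rest g' P|]]).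
  case/existsP => g' /existsP[P /and5P[cg' /eqP eg /eqP sl' PM /andP[Pt r2]]].
  by apply: (single g' P) => //; split=> // h /mg.2; rewrite eg.
rewrite negb_exists => /forallP none; exfalso.
apply: (@exceptional_false g P0) => //; first exact: (subsetP hM).
move=> g' P mg' sl' PM Pt; rewrite leqNgt; apply/negP => r2.
have := none g'; rewrite negb_exists => /forallP/(_ P)/negP; apply.
rewrite mg'.1 sl' PM Pt r2 eqxx !andbT /= eqn_leq mg.2 ?mg'.2 //; exact: mg'.1.
Qed.

End Configuration.
End Spare.
End Ohba.

(** * Frequent colours and the final double counting *)

Lemma exists_top (T : finType) (w : T -> nat) (A : {set T}) q : q <= #|A| ->
  exists B : {set T}, [/\ B \subset A, #|B| = q &
    forall x y, x \in B -> y \in A :\: B -> w y <= w x].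
Proof.
elim: q => [_|q IHq lt]; first by exists set0; rewrite sub0set cards0; split=> // x y;
  rewrite in_set0.
have [B [BA cB Btop]] := IHq (ltnW lt).
have [e|[y0 y0A]] := set_0Vmem (A :\: B).
  by move: lt; rewrite -cB ltnNge subset_leq_card // -setD_eq0 e.
case: (arg_maxnP w y0A) => y yA ymax.
have {}yA : y \in A :\: B := yA.
have yAB := yA; rewrite in_setD in yAB; case/andP: yAB => yB yA'.
exists (y |: B); split=> [||x z].
- by rewrite subUset sub1set yA' BA.
- by rewrite cardsU1 yB cB.
rewrite in_setU1 in_setD in_setU1 negb_or => xB /andP[/andP[zy zB] zA].
have zAB : z \in A :\: B by rewrite in_setD zB.
by case/orP: xB => [/eqP->|xB]; [exact: (ymax z zAB)|exact: Btop].
Qed.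

(* [k1] and [j] count the parts of size 1 and the larger ones, [f] the frequent
   colours, [X = k + h] the colours seen by the violating set, [t] the parts of size 1
   in that set, and [Kc] the colours seen by at most [k - h] vertices; [m] is [gap]. *)
Lemma ohba_arith k n j k1 f m h t X Kc : k1 + j = k -> n <= 2 * k + 1 -> 0 < m ->
  f < j -> k1 < t + m -> t <= k1 -> X = k + h ->
    k * t <= X * (m - 1) + f * (t - (m - 1)) \/ t < m - 1 ->
  m * k + f * k + h * Kc <= f * (n - j) -> k1 < Kc -> (1 < m -> k + 2 * j <= n) -> False.
Proof.
move=> ek en m0 fj kt tk eX hT hdeg hK h2.
have hnk : f * (n - j) <= f * k + f * k1.+1.
  by rewrite -mulnDr leq_mul2l; apply/orP; right; lia.
have hm : m * k + h * Kc <= f * k1.+1 by lia.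
case: (leqP m 1) => m1.
  (* Here [t = k1], and [hT], or [hm] when [k1 = 0], gives [k <= f], against [f < j]. *)
  have e1 : m = 1 by lia.
  subst m; have et : t = k1 by lia.
  subst t; case: (posnP k1) => k0; first by subst k1; lia.
  by case: hT => [|//]; nia.
have {}h2 := h2 m1.
have hx : k.+1 <= 2 * k1.+1 by lia.
have fx : f + k1.+1 <= k by lia.
have m2 : 2 * m < k1.+1.
  have h1 : 2 * f * k1.+1 <= (k - 1) * k1.+1 by rewrite leq_mul2r; apply/orP; right; lia.
  rewrite ltnNge; apply/negP => le.
  have : k1.+1 * k <= 2 * m * k by rewrite leq_mul2r le orbT.
  have -> : k1.+1 * k = (k - 1) * k1.+1 + k1.+1.
    by rewrite mulnBl mul1n [k * _]mulnC subnK // leq_pmulr //; lia.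
  by lia.
case: hT => [hT|]; last by lia.
have [q eq] : exists q, t = q + (m - 1) by exists (t - (m - 1)); lia.
subst t X; move: hT; rewrite addnK => hT.
(* [hq] makes [h * Kc] large and [hm] makes it small; the two clash because [2 * f <= k - 1]. *)
have hq : (k - f) * q <= h * (m - 1).
  move: hT; rewrite mulnDr mulnDl mulnBl.
  by move: (k * q) (k * (m - 1)) (h * (m - 1)) (f * q) => a b c d; clear; lia.
have hq' : k1.+1 + 1 - 2 * m <= q by lia.
have hKm : h * (m - 1) <= h * Kc by rewrite leq_mul2l; apply/orP; right; lia.
have b1 : (k - f) * (k1.+1 + 1 - 2 * m) <= (k - f) * q by rewrite leq_mul2l hq' orbT.
have b2 : k.+1 * (k1.+1 + 1 - 2 * m) <= 2 * (k - f) * (k1.+1 + 1 - 2 * m).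
  by rewrite leq_mul2r; apply/orP; right; lia.
have b3 : 2 * f * k1.+1 <= (k - 1) * k1.+1 by rewrite leq_mul2r; apply/orP; right; lia.
have b4 : k * (k1.+1 + 1 - 2 * m) + 2 * m * k = k * k1.+1 + k.
  rewrite [2 * m * k]mulnC -mulnDr subnK; last by lia.
  by rewrite mulnDr muln1.
have b5 : k.+1 * (k1.+1 + 1 - 2 * m) <= 2 * (h * Kc).
  apply: (leq_trans b2); rewrite -mulnA leq_mul2l /=.
  exact: leq_trans b1 (leq_trans hq hKm).
have b6 : 2 * (h * Kc) + 2 * m * k <= (k - 1) * k1.+1.
  by apply: (leq_trans _ b3); rewrite -!mulnA -mulnDr leq_mul2l /= addnC.
move: b4 b5 b6 fx; rewrite [k.+1 * _]mulSn [(k - 1) * _]mulnBl.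
move: (k * (_ - _)) (2 * (h * Kc)) (2 * m * k) (k * k1.+1) => w x y z.
by clear; lia.
Qed.

Section OhbaFalse.
Variables (V K C : finType) (c0 : C) (pi : V -> K) (L : V -> {set C}).
Hypothesis crit : critical pi L #|K|.
Local Notation Cs := (nbh L setT).
Hypothesis matchable : forall U : {set C}, U \subset Cs -> #|U| <= #|seen L U|.
Hypothesis fewC : #|Cs| < #|V|.
Let Lr := critical_list crit.
Let nkr := critical_order crit.

Local Notation prt P := [set v | pi v == P].
Local Notation s P := #|prt P|.
Local Notation gap := (gap L).
Local Notation multi := (multi pi).
Local Notation lone := (lone pi).
Local Notation sees := (sees L).

Lemma spare_almost (J : {set C}) : J \subset Cs -> #|J| = #|multi| ->
  exists f, almost pi L J f.
Proof.
move=> JC cJ; have [mu [muL muI muT]] := spare_matching c0 crit matchable fewC JC cJ.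
exact: (ex_almost c0 crit fewC JC cJ muL muI muT).
Qed.

(* A colour of [J] that the violator provides is seen by fewer than [gap] vertices
   of [lone] and by at most [#|K|] vertices, hence is not frequent. *)
Definition frequent := [set c in Cs | (gap <= #|lone :&: sees c|) || (#|K| < #|sees c|)].

(** Frequent colours are taken first, then the most seen of the others. *)
Lemma spare_choice : exists J : {set C}, [/\ J \subset Cs, #|J| = #|multi| &
  J \subset frequent \/ frequent \subset J /\
    forall c d, c \in J :\: frequent -> d \in Cs :\: J -> #|sees d| <= #|sees c|].
Proof.
have FC : frequent \subset Cs by apply/subsetP => c; rewrite in_set => /andP[].
have multiC : #|multi| <= #|Cs|.
  apply: leq_trans (max_card _) _;
    have /card_gt0P[v _] : 0 < #|V| by apply: leq_ltn_trans fewC.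
  by rewrite -(Lr v); apply/subset_leq_card/list_sub.
case: (leqP #|multi| #|frequent|) => h.
  have [J JF cJ] := exists_subset_card h; exists J; split=> //; last by left.
  exact: subset_trans FC.
have [B [BA cB Btop]] := @exists_top _ (fun c =>
  #|sees c|) (Cs :\: frequent) (#|multi| - #|frequent|) (ltac:(by rewrite cardsD
    (setIidPr FC) leq_sub2r)).
have dj : frequent :&: B = set0.
  apply/setP => c; rewrite in_setI in_set0; apply/negP => /andP[cF /(subsetP BA)].
  by rewrite in_setD cF.
exists (frequent :|: B); split.
- by rewrite subUset FC (subset_trans BA) ?subsetDl.
- by rewrite cardsU dj cards0 subn0 cB subnKC // ltnW.
right; split=> [|c d]; first exact: subsetUl.
rewrite !in_setD !in_setU negb_or => /andP[cF]; rewrite (negbTE cF) => cB'.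
by case/andP => /andP[dF dB] dC; apply: Btop => //; rewrite !in_setD dF dB.
Qed.

(** By [no_common_multi], each part of [multi] has a vertex whose list lacks [c]. *)
Lemma deg_multi c : #|sees c| + #|multi| <= #|V|.
Proof.
rewrite -(cardsC (sees c)) leq_add2l.
have sub : multi \subset pi @: (~: sees c).
  apply/subsetP => P PM; have /subsetPn[v vP vc] := no_common_multi crit c PM.
  apply/imsetP; exists v; first by rewrite in_setC.
  by move: vP; rewrite in_set => /eqP.
exact: leq_trans (subset_leq_card sub) (leq_imset_card _ _).
Qed.

(** A part of size 2 has disjoint lists, so [2 * #|K| <= #|Cs|], which [1 < gap] excludes. Parts of
    [multi] thus have at least 3 vertices. *)
Lemma no_pair_part : 1 < gap -> #|K| + 2 * #|multi| <= #|V|.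
Proof.
move=> g2; rewrite -(card_lone crit).
have s3 P : P \in multi -> 2 < s P.
  move=> PM; rewrite ltn_neqAle [1 < _](_ : _ = true) ?andbT; last by move: PM;
    rewrite in_set.
  apply/negP => /eqP sP.
  have /card_gt1P[u [v [uP vP nuv]]] : 1 < s P by rewrite -sP.
  have prtE : prt P = [set u; v].
    apply/esym/eqP; rewrite eqEcard cards2 nuv -sP leqnn andbT.
    by apply/subsetP => w; rewrite in_set2 => /orP[] /eqP->.
  have dj : L u :&: L v = set0.
    apply/setP => c; rewrite in_set0 in_setI; apply/negP => /andP[cu cv].
    have /negP := no_common_multi crit c PM; apply; rewrite prtE; apply/subsetP => w.
    by rewrite in_set2 in_set => /orP[] /eqP->.
  have : #|L u :|: L v| <= #|Cs| by apply: subset_leq_card; rewrite subUset !list_sub.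
  rewrite cardsU dj cards0 !Lr; move: g2 nkr; rewrite /gap; clear; lia.
have -> : #|V| = #|lone| + #|~: lone| by rewrite cardsC.
suff : 3 * #|multi| <= #|~: lone| by clear; lia.
rewrite (card_fibres (p := pi) (B := multi)) => [|v];
  last by rewrite in_setC [v \in lone]in_set negbK.
rewrite mulnC -sum_nat_const; apply: leq_sum => P PM; apply: leq_trans (s3 P PM) _.
apply: subset_leq_card; apply/subsetP => v; rewrite in_set => /eqP vP.
by rewrite in_set in_setC [v \in lone]in_set negbK vP PM eqxx.
Qed.

Lemma ohba_false : False.
Proof.
have [J [JC cJ Jtop]] := spare_choice.
have [f [f_pi fC fL fm]] := spare_almost JC cJ.
have fLm x : 1 < #|node_class f x| -> x \in node_list L f x.
  move=> x2; apply/bigcapP => v /eqP vx; case: (fL v); rewrite vx // => -[_ uni].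
  have /card_gt1P[a [b []]] := x2; rewrite !in_set => /eqP ax /eqP bx.
  by case/eqP; rewrite (uni a ax) (uni b bx).
have idI : {in [pred x | 1 < #|node_class f x|] &, injective (fun x : C => x)} by [].
have [S [Simg ltS viol0]] := violator c0 crit f_pi fLm idI.
pose Z := [set v | (f v \in S) && (#|node_class f (f v)| == 1)].
pose b := #|[set x in S | 1 < #|node_class f x|]|.
pose e := #|~: (pi @: Z)|.
have viol : [\/ Z = setT, #|K| + e < #|K| + b | #|[set v | f v \notin S]| + e < b] := viol0.
have gap0 : 0 < gap by rewrite subn_gt0.
have e_lt : e < gap.
  have bm : b <= gap.
    by apply: leq_trans fm; apply: subset_leq_card; apply/subsetP => x;
      rewrite !in_set => /andP[].
  apply: leq_trans bm; case: viol => [ZT||].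
  - have fI : injective f.
      move=> u v euv; have : v \in Z by rewrite ZT in_setT.
      rewrite in_set => /andP[_ /cards1P[w ew]].
      have : v \in node_class f (f v) by rewrite in_set.
      have : u \in node_class f (f v) by rewrite in_set euv.
      by rewrite ew !in_set1 => /eqP-> /eqP->.
    have : #|f @: [set: V]| <= #|Cs|.
      by apply: subset_leq_card; apply/subsetP => x /imsetP[v _ ->].
    by rewrite card_imset // cardsT leqNgt fewC.
  - by rewrite ltn_add2l.
  - by apply: leq_ltn_trans; apply: leq_addl.
set X := nbh (node_list L f) S in ltS.
have ZX v : v \in Z -> L v \subset X.
  rewrite in_set => /andP[vS /cards1P[w ew]]; apply: subset_trans (bigcup_sup (f v) vS).
  apply/bigcapsP => u /eqP uv; have : v \in node_class f (f v) by rewrite in_set.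
  have : u \in node_class f (f v) by rewrite in_set uv.
  by rewrite ew !in_set1 => /eqP-> /eqP->.
have XC : X \subset Cs.
  apply/subsetP => c /nbhP[x /(subsetP Simg)/imsetP[v _ ->] /bigcapP/(_ v (eqxx _))].
  exact: (subsetP (list_sub L v)).
(* A class of size at least 2 would put its own colour into [X]. So [c] is held by one vertex [w],
   whose list lies in [X] and lacks [c]; hence [c] is in [J]. *)
have [c cS cX] : exists2 c, c \in S & c \notin X.
  by apply/subsetPn; apply: contraL ltS => /subset_leq_card; rewrite leqNgt.
have [w _ ew] := imsetP (subsetP Simg c cS).
have c1 : #|node_class f c| = 1.
  apply/eqP; rewrite eqn_leq leqNgt card_gt0; apply/andP; split.
    by apply: contraNN cX => /fLm cl2; apply/nbhP; exists c.
  by apply/set0Pn; exists w; rewrite in_set ew.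
have wZ : w \in Z by rewrite in_set -ew cS c1.
have cJ' : c \in J.
  case: (fL w) => [|[]]; rewrite -ew // => cw.
  by case/negP: cX; apply: (subsetP (ZX w wZ)).
have seesZ u : u \in sees c -> u \notin Z.
  by rewrite in_set => cu; apply: contraNN cX => /ZX/subsetP; apply.
have lone_out (A : {set V}) : A \subset lone -> [disjoint A & Z] -> #|A| <= e.
  move=> Al dA; have pI : {in A &, injective pi}.
    by move=> u v uA _; apply: (lone_inj (subsetP Al u uA)).
  rewrite -(card_in_imset pI); apply: subset_leq_card; apply/subsetP => P /imsetP[u uA ->].
  rewrite in_setC; apply/negP => /imsetP[v vZ euv].
  by move: (disjointFr dA uA); rewrite (lone_inj (subsetP Al u uA) euv) vZ.
have degT : #|lone :&: sees c| < gap.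
  apply: leq_ltn_trans e_lt; apply: lone_out; first exact: subsetIl.
  by apply/pred0P => u /=; rewrite in_setI; apply/negP => /andP[/andP[_ /seesZ/negP]].
(* As [c] is not in [X], each class in [S] has a vertex that does not see [c]. *)
have degS : #|sees c| + #|S| <= #|V|.
  rewrite -(cardsC (sees c)) leq_add2l; apply: leq_trans (leq_imset_card f _).
  apply: subset_leq_card; apply/subsetP => x xS.
  have /bigcapP nx : c \notin node_list L f x by apply: contraNN cX => cx; apply/nbhP;
    exists x.
  have /exists_inP[u ux cu] : [exists u in node_class f x, c \notin L u].
    apply: contra_notT nx => /exists_inPn h u ux; have := h u; rewrite negbK; apply.
    by rewrite in_set.
  by apply/imsetP; exists u; rewrite ?in_setC ?in_set //; move: ux; rewrite in_set => /eqP.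
have Xk : #|K| <= #|X| by rewrite -(Lr w); apply/subset_leq_card/ZX.
pose h := #|X| - #|K|.
have eX : #|X| = #|K| + h by rewrite subnKC.
have degh : #|sees c| + h <= #|K| by move: degS ltS nkr; rewrite eX; clear; lia.
have cF : c \notin frequent.
  rewrite in_set negb_and negb_or -ltnNge degT -leqNgt /= orbC; apply/orP; left.
  exact: leq_trans (leq_addr _ _) degh.
case: Jtop => [/subsetP/(_ c cJ')|[FJ top]]; first by rewrite (negbTE cF).
have FltJ : #|frequent| < #|multi|.
  by rewrite -cJ; apply: proper_card; apply/properP; split=> //; exists c.
have degF d : d \in Cs -> d \notin frequent ->
  #|lone :&: sees d| < gap /\ #|sees d| <= #|K|.
  by move=> dC; rewrite in_set dC /= negb_or -ltnNge -leqNgt => /andP[].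
pose t := #|lone :&: Z|.
have kt : #|lone| <= t + e.
  rewrite -(cardsID Z lone) leq_add2l; apply: lone_out; first exact: subsetDl.
  by apply/pred0P => u /=; rewrite in_setD; case: (u \in Z); rewrite ?andbF.
have tk : t <= #|lone| by rewrite subset_leq_card ?subsetIl.
(* Counts pairs over [lone :&: Z], whose lists lie in [X]: a colour that is not frequent occurs at
   most [gap - 1] times there. *)
have hT : #|K| * t <= #|X| * (gap - 1) + #|frequent| * (t - (gap - 1)) \/ t < gap - 1.
  case: (ltnP t (gap - 1)) => tg; [by right|left].
  have -> : #|K| * t = \sum_(v in lone :&: Z) #|L v|.
    by rewrite mulnC -sum_nat_const; apply: eq_bigr => v _; rewrite Lr.
  rewrite (eq_bigr (fun v => \sum_(d in X | d \in L v) 1)) => [|v]; last first.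
    rewrite in_setI => /andP[_ vZ]; rewrite -sum1_card; apply: eq_bigl => d.
    by case: (boolP (d \in L v)) => dv; rewrite ?andbF // andbT (subsetP (ZX v vZ)).
  rewrite (exchange_big_dep (mem X)) /=; last by move=> v d _ /andP[].
  apply: leq_trans (_ : \sum_(d in X) ((gap - 1) + (if d \in frequent then t - (gap - 1)
    else 0)) <= _).
    apply: leq_sum => d dX.
    have -> : \sum_(v in lone :&: Z | (d \in X) && (d \in L v)) 1 = #|lone :&: Z :&: sees
      d|.
      by rewrite -sum1_card; apply: eq_bigl => v;
        rewrite dX [RHS]in_setI [v \in sees d]in_set.
    case: ifP => dF.
      by rewrite subnKC // subset_leq_card ?subsetIl.
    have [] := degF d (subsetP XC d dX) (negbT dF) => lt _.
    have : #|lone :&: Z :&: sees d| <= #|lone :&: sees d|.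
      by apply: subset_leq_card; apply: setSI; apply: subsetIl.
    by move: lt; clear; lia.
  rewrite big_split sum_nat_const leq_add2l -big_mkcondr sum_nat_const leq_mul2r.
  apply/orP; right; apply: subset_leq_card; apply/subsetP => d;
    rewrite unfold_in => /andP[] //.
pose Kc := #|c |: (Cs :\: J)|.
have eKc : Kc = #|Cs| - #|multi| + 1.
  by rewrite /Kc cardsU1 in_setD cJ' cardsD (setIidPr JC) cJ addnC.
(* Sums the degrees of all colours: at most [#|V| - #|multi|] for frequent ones, [#|K| - h] for [c]
   and the colours outside [J], and [#|K|] for the rest. *)
have hdeg : gap * #|K| + #|frequent| * #|K| + h * Kc <= #|frequent| * (#|V| - #|multi|).
  have tot : #|V| * #|K| = \sum_(d in Cs) #|sees d|.
    rewrite -sum_nat_const.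
    rewrite (eq_bigr (fun v => \sum_(d in Cs | d \in L v) 1)) => [|v _]; last first.
      rewrite -(Lr v) -sum1_card; apply: eq_bigl => d.
      by case: (boolP (d \in L v)) => dv; rewrite ?andbF // andbT (subsetP (list_sub L v)).
    rewrite (exchange_big_dep (mem Cs)) /=; last by move=> v d _ /andP[].
    by apply: eq_bigr => d dC; rewrite -sum1_card; apply: eq_bigl => v;
      rewrite dC [RHS]in_set.
  have FC : frequent \subset Cs by apply: subset_trans FJ JC.
  have KC : c |: (Cs :\: J) \subset Cs by rewrite subUset sub1set (subsetP JC) ?subsetDl.
  have sumif (A : {set C}) q : A \subset Cs ->
    \sum_(d in Cs) (if d \in A then q else 0) = #|A| * q.
    move=> AC; rewrite -big_mkcondr sum_nat_const; congr (_ * _); apply: eq_card => d.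
    by rewrite unfold_in; apply/andP/idP => [[]//|dA]; split=> //; apply: (subsetP AC).
  have : \sum_(d in Cs) (#|sees d| + ((if d \in frequent then #|K| else 0)
        + (if d \in c |: (Cs :\: J) then h else 0)))
      <= \sum_(d in Cs) (#|K| + (if d \in frequent then #|V| - #|multi| else 0)).
    apply: leq_sum => d dC; case: (boolP (d \in frequent)) => dF.
      have dJ := subsetP FJ d dF.
      have -> : (d \in c |: (Cs :\: J)) = false.
        by rewrite in_setU1 in_setD dJ /= orbF; apply/eqP => edc; rewrite -edc dF in cF.
      by rewrite addn0 addnC leq_add2l; have := deg_multi d; clear; lia.
    rewrite add0n addn0; have [_ dk] := degF d dC dF.
    case: ifP => [|_]; last by rewrite addn0.
    rewrite in_setU1 => /orP[/eqP->//|dJ]; apply: leq_trans degh; rewrite leq_add2r.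
    by apply: top => //; rewrite in_setD cF.
  rewrite !big_split /= -tot !sumif // !sum_nat_const -/Kc [Kc * h]mulnC /gap mulnBl.
  have := leq_mul (ltnW fewC) (leqnn #|K|).
  move: (#|V| * _) (#|Cs| * _) (#|frequent| * (_ - _)) (#|frequent| * _) (h * Kc).
  by clear; lia.
apply: (@ohba_arith #|K| #|V| #|multi| #|lone| #|frequent| gap h t #|X| Kc) => //.
- exact: (card_lone crit).
- by move: nkr; clear; lia.
- by move: kt e_lt; clear; lia.
- have : #|K| <= #|Cs| by rewrite -(Lr w); apply/subset_leq_card/list_sub.
  by rewrite eKc; have := card_lone crit; clear; lia.
- exact: no_pair_part.
Qed.

End OhbaFalse.

(* The induction *)
From mathcomp Require Import boolp.

(** Otherwise the matching of colours into vertices is onto, and every vertex gets a colour of its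
    own. *)
Lemma few_colours (V K C : finType) (c0 : C) (pi : V -> K) (L : V -> {set C}) :
  (forall U : {set C}, U \subset nbh L setT -> #|U| <= #|seen L U|) ->
  ~ listcol pi L setT -> #|nbh L setT| < #|V|.
Proof.
move=> match_ nL; rewrite ltnNge; apply/negP => le.
case: (set_0Vmem [set: V]) => [V0|[v0 _]].
  by apply: nL; exists (fun=> c0); rewrite V0; split=> ?; rewrite in_set0.
have [S SC|m [mL mI]] := @hall _ _ v0 (fun c => [set v | c \in L v]) (nbh L setT).
  by rewrite -seenE match_.
have mT v : v \in m @: nbh L setT.
  suff -> : m @: nbh L setT = setT by rewrite in_setT.
  by apply/eqP; rewrite eqEcard subsetT cardsT card_in_imset.
have fP v : exists c, c \in L v /\ m c = v.
  by have /imsetP[c cC e] := mT v; exists c; have := mL c cC; rewrite in_set -e.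
have [f fE] := fin_all_exists fP; apply: nL; exists f; split=> [v _|u v _ _ e].
  by have [] := fE v.
by rewrite -(fE u).2 -(fE v).2 e.
Qed.

Lemma listcol_sub (V K C : finType) (c0 : C) (pi : V -> K) (A : {set V}) (L : V ->
  {set C}) :
  listcol (fun x : {v | v \in A} => pi (val x)) (fun x => L (val x)) setT ->
  listcol pi L A.
Proof.
move=> [f [fL fP]]; exists (fun v => if insub v is Some x then f x else c0).
split=> [v vA|u v uA vA]; first by rewrite insubT; apply: (fL (Sub v vA)).
by rewrite !insubT => /(fP (Sub u uA) (Sub v vA)); apply; rewrite in_setT.
Qed.

(** Induction on [#|V|], then on the number of colours, after reducing to surjective [pi] and lists
    of size exactly [r]. Counting parts by the image of [pi] lets the hypothesis apply to vertex
    sets that miss parts. *)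
Lemma listcol_large (C : finType) (c0 : C) (V K : finType) (pi : V -> K)
    (L : V -> {set C}) (r : nat) :
  #|pi @: setT| <= r -> #|V| + #|pi @: setT| <= 3 * r + 1 ->
  (forall v, r <= #|L v|) -> listcol pi L setT.
Proof.
have [n] := ubnP #|V|; elim: n => // n IHn in V K pi L r *; rewrite ltnS => leVn.
wlog piS : K pi / forall P, exists v, pi v = P.
  move=> hw; pose K' := {P | P \in pi @: [set: V]}.
  pose pi' v : K' := Sub (pi v) (imset_f pi (in_setT v)).
  have piS P : exists v, pi' v = P.
    by have /imsetP[v _ e] := valP P; exists v; apply: val_inj.
  have -> : #|pi @: [set: V]| = #|pi' @: [set: V]|.
    rewrite -(card_imset _ (val_inj : injective (val : K' -> K))) -imset_comp.
    by apply: eq_card => P; apply/imsetP/imsetP => -[v vT ->]; exists v.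
  move=> h1 h2 h3; have [f [fL fP]] := hw _ pi' piS h1 h2 h3.
  by exists f; split=> // u v uT vT /(fP u v uT vT)/(congr1 val).
have -> : #|pi @: setT| = #|K|.
  by rewrite -cardsT; apply: eq_card => P; rewrite in_setT; have [v <-] := piS P;
    rewrite imset_f ?in_setT.
move=> kr nkr Lr.
suff {L Lr} exact_lists (L : V -> {set C}) : (forall v, #|L v| = r) -> listcol pi L setT.
  have exB v : exists B : {set C}, B \subset L v /\ #|B| = r.
    by have [B BL cB] := exists_subset_card (Lr v); exists B.
  have [L' L'P] := fin_all_exists exB.
  have := exact_lists L' (fun v => (L'P v).2); apply: listcolS => v _.
  by have [] := L'P v.
have [q] := ubnP #|nbh L setT|; elim: q => // q IHq in L *; rewrite ltnS => leq Lr.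
apply: contrapT => nL.
have match_ := @colours_matchable _ _ _ c0 pi L r Lr (fun L' hL' lt =>
  IHq L' (leq_trans lt leq) hL') nL.
have few := few_colours c0 match_ nL.
have crit : critical pi L r.
  split=> // A AT L' r' hk hn hL; apply: (listcol_sub c0).
  have ltA : #|A| < #|V|.
    rewrite -cardsT; apply: proper_card; rewrite properEneq AT; exact: subsetT.
  have cA : #|{: {v | v \in A}}| = #|A| by rewrite card_sig; apply: eq_card.
  have eA : (fun x : {v | v \in A} => pi (val x)) @: setT = pi @: A.
    apply/setP => P; apply/imsetP/imsetP => [[x _ ->]|[v vA ->]].
      by exists (val x) => //; apply: valP.
    by exists (Sub v vA).
  apply: (IHn _ _ _ _ r'); rewrite ?cA ?eA //.
    exact: leq_trans ltA leVn.
  by move=> x; apply/hL/valP.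
case: (ltnP #|K| r) => ltk; first exact: (beyond_false c0 crit ltk few).
have er : r = #|K| by apply/eqP; rewrite eqn_leq kr ltk.
by subst r; apply: (ohba_false c0 crit match_ few).
Qed.

(* From finite lists to choosability *)
From mathcomp Require Import classical_sets functions cardinality.

(** The classes of a [k]-colouring serve as parts: a colour repeated only inside a part is never
    repeated along an edge. *)
Lemma choosable_large (G : sgraph) k r : colourable G k ->
  (k <= r)%N -> (#|G| + k <= 3 * r + 1)%N -> choosable G r.
Proof.
move=> [pi piP] kr nkr C L hL.
have [v0|G0] := pickP (@predT G); last first.
  have f (v : G) : C by have := G0 v.
  by exists f; split=> v; have := G0 v.
move=> _.
have /choice[rep repP] : forall v, exists g : 'I_r ->
  C, (forall i, L v (g i)) /\ injective g.
  move=> v; have /card_leP[g] := hL v.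
  have lt (i : 'I_r) : (`I_r)%classic (val i) by exact: ltn_ord.
  exists (fun i => val (g (SigSub (mem_set (lt i))))); split=> [i|i j];
    first exact: set_valP.
  move=> /val_inj e; have := @inj _ _ _ g _ _ (mem_set I) (mem_set I) e.
  by move=> /(congr1 val) /= /val_inj.
pose val_ (x : G * 'I_r) := rep x.1 x.2.
(* Colours are encoded in the finite type of pairs [(v, i)]; the canonical pair makes equal codes
   mean equal colours. *)
pose canon (x : G * 'I_r) := odflt x [pick y | `[< val_ y = val_ x >]].
have canonV x : val_ (canon x) = val_ x.
  by rewrite /canon; case: pickP => [y /asboolP|].
have canonE x y : val_ x = val_ y -> canon x = canon y.
  move=> e; rewrite /canon e; case: pickP => // /(_ y) /asboolP. by [].
pose L' v := [set canon (v, i) | i : 'I_r].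
have r0 : (0 < r)%N by apply: leq_trans kr; case: k pi {piP nkr} => [|//] pi; case: (pi v0).
have [|||f [fL fP]] := @listcol_large _ (v0, Ordinal r0) _ _ pi L' r.
- by apply: leq_trans (max_card _) _; rewrite card_ord.
- by apply: leq_trans nkr; rewrite leq_add2l; apply: leq_trans (max_card _) _;
  rewrite card_ord.
- move=> v; rewrite card_imset ?card_ord // => i j /(congr1 val_).
  by rewrite !canonV; apply: (repP v).2.
have fV v : exists i, f v = canon (v, i).
  by have /imsetP[i _ ->] := fL v (finset.in_setT v); exists i.
exists (val_ \o f); split=> [x y exy /= e|v /=].
  apply: (piP _ _ exy); apply: fP; rewrite ?finset.in_setT //.
  by have [i fx] := fV x; have [j fy] := fV y; rewrite fx fy; apply: canonE; move: e;
    rewrite fx fy !canonV.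
by have [i ->] := fV v; rewrite canonV; apply: (repP v).1.
Qed.

(* The ceiling bound *)
From mathcomp Require Import lra.
Import Order.TTheory GRing.Theory Num.Theory.
Local Open Scope ring_scope.

(** An integer is at most a ceiling as soon as its predecessor is below the argument. *)
Lemma ceil_third_ge (a b q : nat) : (3 * q <= a + b + 1)%N ->
  q%:Z <= Num.ceil ((a%:R + b%:R - 1) / 3%:R : rat).
Proof.
rewrite -(ler_nat rat) natrM !natrD => h.
rewrite -[q%:Z](subrK 1) lezD1 ceil_gt_int ltr_pdivlMr //.
rewrite rmorphB /= -pmulrn.
move: h; move: (q%:R : rat) (a%:R : rat) (b%:R : rat) => x y z h.
lra.
Qed.

Theorem theorem5p2 (G : sgraph) :
  (ch G)%:Z <=
    Num.max (chi G)%:Z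
      (Num.ceil ((#|G|%:R + (chi G)%:R - 1) / 3%:R : rat)).
Proof.
have colG : colourable G (chi G) by rewrite /chi; case: ex_minnP => k /asboolP.
move: (chi G) colG => k colG.
(* The least [q] with [#|G| + k <= 3 * q + 1]. *)
pose q := ((#|G| + k + 1) %/ 3)%N.
have chR : (ch G <= maxn k q)%N.
  rewrite /ch; case: ex_minnP => c _; apply; apply/asboolP.
  apply: choosable_large colG _ _; first exact: leq_maxl.
  by rewrite /q; lia.
rewrite le_max; case/orP: (leq_total q k) chR => h.
  by rewrite (maxn_idPl h) -lez_nat => ->.
rewrite (maxn_idPr h) -lez_nat => /le_trans chq; apply/orP; right; apply: chq.
by apply: ceil_third_ge; rewrite /q; lia.
Qed.
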